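(* Let $E\subset\mathbb{H}^n$ be a closed set with $C^1$ boundary $S$. Then $\operatorname{reach}(E,q)$ approaches $0$ when $q\in S$ approaches the singular set $S_0$; that is, for every $q_0\in S_0$, $\operatorname{reach}(E,q)\to 0$ as $q\to q_0$, $q\in S$.
   Context: $\mathbb{H}^n$ is $\mathbb{R}^{2n+1}$ with coordinates $(x_1,y_1,\ldots,x_n,y_n,t)$, with the left-invariant vector fields $X_i=\partial_{x_i}+y_i\partial_t$, $Y_i=\partial_{y_i}-x_i\partial_t$ ($1\le i\le n$), $T=\partial_t$, and $n\ge 1$. The horizontal distribution $\mathcal{H}$ is spanned by the $X_i,Y_i$; $\langle\cdot,\cdot\rangle$ is the Riemannian metric making $\{X_i,Y_i,T\}$ orthonormal. $d$ is the Carnot-Carathéodory distance (infimum of Riemannian lengths of piecewise smooth curves tangent to $\mathcal{H}$ joining two points), and $B(q,r)$ its open balls. $\operatorname{Unp}(E)$ is the set of points $p\in\mathbb{H}^n$ for which there is a unique point of $E$ nearest to $p$ (with respect to $d$). For $q\in E$, $\operatorname{reach}(E,q)$ is the supremum of the $r>0$ with $B(q,r)\subset\operatorname{Unp}(E)$ ($0$ if there is none). $S_0$ is the set of $q\in S$ with $T_qS=\mathcal{H}_q$. *)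

(* Defs.v *)
From HB Require Import structures.
From mathcomp Require Import all_boot all_order all_algebra.
From mathcomp Require Import all_classical all_reals all_analysis.

Set Implicit Arguments.
Unset Strict Implicit.
Unset Printing Implicit Defensive.

Import Order.TTheory GRing.Theory Num.Theory.
Import numFieldNormedType.Exports.

Local Open Scope classical_set_scope.
Local Open Scope ring_scope.

(* The point (x_1, y_1, ..., x_n, y_n, t) of R^(2n+1) is stored as ((x, y), t);
   tangent vectors are identified with their components in the coordinate
   frame, so they have the same type. *)
Definition heis (R : realType) (n : nat) : normedModType R :=
  ('rV[R]_n * 'rV[R]_n * R)%type.

Section Heisenberg.
Context {R : realType} {n : nat}.
Local Notation H := (heis R n).
Implicit Types (p q v w : H) (E S : set H) (i j : 'I_n).

Definition xc p i : R := p.1.1 0 i.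
Definition yc p i : R := p.1.2 0 i.
Definition tc p : R := p.2.

Definition vfX i p : H := ((delta_mx 0 i, 0), yc p i).
Definition vfY i p : H := ((0, delta_mx 0 i), - xc p i).
Definition vfT p : H := ((0, 0), 1).

Definition horizontal p : set H :=
  [set v | exists a b : 'I_n -> R,
     v = \sum_i a i *: vfX i p + \sum_i b i *: vfY i p].

(* Component of v along T in the frame (X_i, Y_i, T) at p; the components along
   X_i and Y_i are xc v i and yc v i (see frame_decomposition). *)
Definition Tcomp p v : R :=
  tc v - \sum_i (xc v i * yc p i - yc v i * xc p i).

Definition metric p v w : R :=
  \sum_i (xc v i * xc w i + yc v i * yc w i) + Tcomp p v * Tcomp p w.

Lemma frame_decomposition p v :
  v = \sum_i xc v i *: vfX i p + \sum_i yc v i *: vfY i p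
      + Tcomp p v *: vfT p.
Proof.
have s11 (F : 'I_n -> H) : (\sum_i F i).1.1 = \sum_i (F i).1.1.
  by elim/big_rec2: _ => // i a b _ <-.
have s12 (F : 'I_n -> H) : (\sum_i F i).1.2 = \sum_i (F i).1.2.
  by elim/big_rec2: _ => // i a b _ <-.
have s2 (F : 'I_n -> H) : (\sum_i F i).2 = \sum_i (F i).2.
  by elim/big_rec2: _ => // i a b _ <-.
have E11 : (\sum_i xc v i *: vfX i p + \sum_i yc v i *: vfY i p
      + Tcomp p v *: vfT p).1.1 = v.1.1.
  rewrite /= s11 s11 /= scaler0 addr0 [X in _ + X]big1 ?addr0; last first.
    by move=> i _; rewrite /= scaler0.
  by rewrite -row_sum_delta.
have E12 : (\sum_i xc v i *: vfX i p + \sum_i yc v i *: vfY i p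
      + Tcomp p v *: vfT p).1.2 = v.1.2.
  rewrite /= s12 s12 /= scaler0 addr0 [X in X + _]big1 ?add0r; last first.
    by move=> i _; rewrite /= scaler0.
  by rewrite -row_sum_delta.
have E2 : (\sum_i xc v i *: vfX i p + \sum_i yc v i *: vfY i p
      + Tcomp p v *: vfT p).2 = v.2.
  rewrite /= s2 s2 /= -big_split /= /Tcomp [_ *: 1]mulr1 addrC.
  rewrite [X in _ + X](eq_bigr (fun i => xc v i * yc p i - yc v i * xc p i)).
    by rewrite subrK.
  by move=> i _; rewrite -mulrN.
move: E11 E12 E2; set s := (_ + _).
by case: v s => [[v1 v2] v3] [[s1 s2'] s3] /= -> -> ->.
Qed.

Lemma Tcomp_vfX i p : Tcomp p (vfX i p) = 0.
Proof.
rewrite /Tcomp (bigD1 i)//= big1 => [|j ji]; rewrite /xc /yc /tc /= !mxE ?eqxx.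
  by rewrite mul1r mul0r subr0 addr0 subrr.
by rewrite (negbTE ji) andbF !mul0r subr0.
Qed.

Lemma Tcomp_vfY i p : Tcomp p (vfY i p) = 0.
Proof.
rewrite /Tcomp (bigD1 i)//= big1 => [|j ji]; rewrite /xc /yc /tc /= !mxE ?eqxx.
  by rewrite mul1r mul0r sub0r addr0 subrr.
by rewrite (negbTE ji) andbF !mul0r subr0.
Qed.

Lemma Tcomp_vfT p : Tcomp p (vfT p) = 1.
Proof.
by rewrite /Tcomp big1 => [|j _]; rewrite /xc /yc /tc /= ?mxE ?mul0r subr0.
Qed.

Lemma metric_XX p i j : metric p (vfX i p) (vfX j p) = (i == j)%:R.
Proof.
rewrite /metric !Tcomp_vfX mul0r addr0 (bigD1 i)//= big1 => [|k ki];
  rewrite /xc /yc /= !mxE ?eqxx.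
  by rewrite mul1r mul0r !addr0.
by rewrite (negbTE ki) andbF !mul0r addr0.
Qed.

Lemma metric_YY p i j : metric p (vfY i p) (vfY j p) = (i == j)%:R.
Proof.
rewrite /metric !Tcomp_vfY mul0r addr0 (bigD1 i)//= big1 => [|k ki];
  rewrite /xc /yc /= !mxE ?eqxx.
  by rewrite mul1r mul0r add0r addr0.
by rewrite (negbTE ki) andbF !mul0r addr0.
Qed.

Lemma metric_TT p : metric p (vfT p) (vfT p) = 1.
Proof.
rewrite /metric Tcomp_vfT mulr1 big1 ?add0r// => i _.
by rewrite /xc /yc /= !mxE mul0r addr0.
Qed.

Lemma metric_XY p i j : metric p (vfX i p) (vfY j p) = 0.
Proof.
rewrite /metric Tcomp_vfX mul0r addr0 big1// => k _.
by rewrite /xc /yc /= !mxE mulr0 mul0r addr0.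
Qed.

Lemma metric_XT p i : metric p (vfX i p) (vfT p) = 0.
Proof.
rewrite /metric Tcomp_vfX mul0r addr0 big1// => k _.
by rewrite /xc /yc /= !mxE !mulr0 addr0.
Qed.

Lemma metric_YT p i : metric p (vfY i p) (vfT p) = 0.
Proof.
rewrite /metric Tcomp_vfY mul0r addr0 big1// => k _.
by rewrite /xc /yc /= !mxE !mulr0 addr0.
Qed.

Definition smooth (g : R -> H) : Prop :=
  forall (k : nat) (s : R), derivable g^`(k)%classic s 1.

(* Smoothness up to the endpoints of [a, b]. *)
Definition smooth_on (a b : R) (g : R -> H) : Prop :=
  exists2 h : R -> H, smooth h & {in `[a, b], g =1 h}.

(* The closed pieces share their endpoints, so such a curve is continuous on
   [a, b]; tangency is required in the interior of each piece, where g^`() is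
   the velocity (at the endpoints it then holds for the one-sided ones). *)
Definition horizontal_curve (a b : R) (g : R -> H) : Prop :=
  exists2 s : seq R, itv_partition a b s &
    forall k : nat, (k < size s)%N ->
      let u := nth b (a :: s) k in let v := nth b (a :: s) k.+1 in
      smooth_on u v g /\ {in `]u, v[, forall r, horizontal (g r) (g^`()%classic r)}.

(* g^`() is only meaningless at the finitely many break points of g. *)
Definition curve_length (a b : R) (g : R -> H) : \bar R :=
  (\int[@lebesgue_measure R]_(s in `[a, b])
     (Num.sqrt (metric (g s) (g^`()%classic s) (g^`()%classic s)))%:E)%E.

Definition cc_dist p q : \bar R :=
  ereal_inf [set l | exists a b g,
    [/\ horizontal_curve a b g, g a = p, g b = q & l = curve_length a b g]].

Definition cc_ball q (r : R) : set H := [set p | (cc_dist q p < r%:E)%E].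

Definition nearest E p x : Prop :=
  E x /\ forall y, E y -> (cc_dist p x <= cc_dist p y)%E.

Definition Unp E : set H := [set p | exists! x, nearest E p x].

(* The maximum with 0 only matters when there is no such r (sup = -oo). *)
Definition reach E q : \bar R :=
  maxe 0%E (ereal_sup
    [set r%:E | r in [set r : R | 0 < r /\ cc_ball q r `<=` Unp E]]).

Definition boundary E : set H := closure E `\` E^°.

Definition C1_on (U : set H) (f : H -> R) : Prop :=
  (forall p, U p -> differentiable f p) /\
  (forall v p, U p -> {for p, continuous ('D_v f)}).

Definition C1_hypersurface S : Prop :=
  forall q, S q -> exists (U : set H) (f : H -> R),
    [/\ open U, U q, C1_on U f,
        (forall p, U p -> exists v, 'D_v f p != 0) &
        S `&` U = [set p | U p /\ f p = 0]].

Definition C1_curve (c : R -> H) : Prop :=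
  (forall s : R, derivable c s 1) /\ continuous c^`()%classic.

Definition tangent_space S q : set H :=
  [set v | exists c : R -> H,
     [/\ C1_curve c, (\forall s \near (0 : R), S (c s)), c 0 = q &
         c^`()%classic 0 = v]].

Definition singular_set S : set H :=
  [set q | S q /\ tangent_space S q = horizontal q].

End Heisenberg.

(* Main.v *)
From HB Require Import structures.
Require Import Defs.
From mathcomp Require Import all_boot all_order all_algebra.
From mathcomp Require Import all_classical all_reals all_analysis.
From mathcomp Require Import measurable_realfun.
From mathcomp Require Import ring lra.
Import numFieldNormedType.Exports.
Local Open Scope classical_set_scope.
Local Open Scope ring_scope.

(** Let q0 be a singular point of S. If B(q0, r) contained only points with a
    unique nearest point for some r > 0, then the continuous projection onto E
    would let one slide away from E: at a point p outside E the distance to E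
    has slope 1 in the direction opposite to the nearest point ([depth_slope]),
    so starting from points outside E close to q0 one reaches the sphere of
    radius r / 2 at points whose distance to E is almost r / 2 ([deep_point]).
    By compactness some p on this sphere has distance r / 2 to E, that is, q0
    is a nearest point of p. This is impossible at a singular point
    ([nearest_singular]): every horizontal direction is tangent to S there, and
    some horizontal direction decreases the distance to p at a positive rate.
    Hence every ball around q0 meets the complement of Unp(E), and by the
    triangle inequality so does every ball of radius 2 r around a point of
    B(q0, r): the reach is at most 2 r there ([corollary3p14]).

    Only two facts on the distance d enter this argument. At a pair of points
    that are not on a common vertical line d^2 is differentiable, its
    differential depends continuously on the pair, and its horizontal gradient
    has norm 2 d. At a pair of distinct points of a vertical line d decreases at
    a positive rate in every horizontal direction; a nearest point in a C1
    hypersurface is therefore never vertically above or below p, because the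
    hypersurface has a horizontal tangent direction ([nearest_nonvertical]).

    Both facts are read off a closed form. Write (z, t) for the coordinates of
    p^-1 q. Then d(p, q)^2 is the maximum over |x| < pi of the functions
      Phi x z t = 2 x t + x cot x |z|^2
    (a supremum when z = 0, where it is 2 pi |t|). That each Phi x is a lower
    bound is a calibration argument ([psi_piece], [curve_calibration]) based on
    a solution of a Riccati equation; that the maximum is attained is the
    computation of the lengths of arcs of circles ([geodesic_nonvertical],
    [geodesic_vertical]). As Phi x z t is a polynomial in (z, t), the function
    Phi x with x optimal at a point supports d^2 from below at this point, with
    explicit derivatives ([N2_increment]); and the optimal x is a continuous
    function of the point because mu, which relates it to t / |z|^2, is
    increasing ([mu_incr]). *)

Set Implicit Arguments.
Unset Strict Implicit.
Unset Printing Implicit Defensive.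

Import Order.TTheory GRing.Theory Num.Theory.

(** * The symplectic structure of the horizontal plane *)

Section Symplectic.
Context {R : realType} {n : nat}.
Local Notation Z := ('rV[R]_n * 'rV[R]_n)%type.
Implicit Types (u v w z : Z) (a b : R).

Definition dot u v : R := \sum_i (u.1 0 i * v.1 0 i + u.2 0 i * v.2 0 i).

(** Multiplication by -i on C^n, with z = x + i y. *)
Definition Jrot u : Z := (u.2, - u.1).

(** The part of the group law that is not additive: the t-coordinate of
    (z, t)(w, s) is t + s + omega z w, and the left-invariant horizontal field
    of components w takes the value (w, omega z w) over z. *)
Definition omega z w : R := dot w (Jrot z).

Lemma dotC u v : dot u v = dot v u.
Proof. by apply: eq_bigr => i _; rewrite mulrC [X in _ + X]mulrC. Qed.

Lemma dotDl u v w : dot (u + v) w = dot u w + dot v w.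
Proof.
by rewrite -big_split; apply: eq_bigr => i _ /=; rewrite !mxE; ring.
Qed.

Lemma dotZl a u v : dot (a *: u) v = a * dot u v.
Proof. by rewrite mulr_sumr; apply: eq_bigr => i _ /=; rewrite !mxE; ring. Qed.

Lemma dotNl u v : dot (- u) v = - dot u v.
Proof. by rewrite -scaleN1r dotZl mulN1r. Qed.

Lemma dotDr u v w : dot u (v + w) = dot u v + dot u w.
Proof. by rewrite dotC dotDl !(dotC u). Qed.

Lemma dotZr a u v : dot u (a *: v) = a * dot u v.
Proof. by rewrite dotC dotZl dotC. Qed.

Lemma dotNr u v : dot u (- v) = - dot u v.
Proof. by rewrite dotC dotNl dotC. Qed.

Lemma dot0l u : dot 0 u = 0.
Proof. by rewrite -(scale0r 0) dotZl mul0r. Qed.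

Lemma dot0r u : dot u 0 = 0.
Proof. by rewrite dotC dot0l. Qed.

Lemma JrotD u v : Jrot (u + v) = Jrot u + Jrot v.
Proof. by rewrite /Jrot /= opprD. Qed.

Lemma JrotZ a u : Jrot (a *: u) = a *: Jrot u.
Proof. by rewrite /Jrot /= -scalerN. Qed.

Lemma JrotN u : Jrot (- u) = - Jrot u.
Proof. by rewrite -scaleN1r JrotZ scaleN1r. Qed.

Lemma JrotK u : Jrot (Jrot u) = - u.
Proof. by case: u. Qed.

Lemma dot_Jrot u v : dot (Jrot u) (Jrot v) = dot u v.
Proof. by apply: eq_bigr => i _; rewrite /= !mxE; ring. Qed.

Lemma dot_JrotC u v : dot u (Jrot v) = - dot v (Jrot u).
Proof. by rewrite -dot_Jrot JrotK dotNr dotC. Qed.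

Lemma dot_Jrotid u : dot u (Jrot u) = 0.
Proof. by have := dot_JrotC u u; lra. Qed.

Lemma dot_Jrotl u : dot (Jrot u) u = 0.
Proof. by rewrite dotC dot_Jrotid. Qed.

Lemma dot_ge0 u : 0 <= dot u u.
Proof. by apply: sumr_ge0 => i _; rewrite addr_ge0// -expr2 sqr_ge0. Qed.

Lemma dot_eq0 u : (dot u u == 0) = (u == 0).
Proof.
apply/eqP/eqP => [/eqP|->]; last by rewrite dot0l.
rewrite psumr_eq0 => [/allP u0|i _]; last first.
  by rewrite addr_ge0// -expr2 sqr_ge0.
have {}u0 i : u.1 0 i = 0 /\ u.2 0 i = 0.
  have := u0 i (mem_index_enum _); rewrite /= paddr_eq0; first last.
  - by rewrite -expr2 sqr_ge0.
  - by rewrite -expr2 sqr_ge0.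
  by rewrite !mulf_eq0 !orbb => /andP[/eqP -> /eqP ->].
case: u u0 => u1 u2 /= u0; congr pair; apply/rowP => i; rewrite mxE;
  by have [] := u0 i.
Qed.

Lemma dot_gt0 u : (0 < dot u u) = (u != 0).
Proof. by rewrite lt_def dot_ge0 dot_eq0 andbT. Qed.

Lemma omegaC z w : omega w z = - omega z w.
Proof. exact: dot_JrotC. Qed.

Lemma omega_id z : omega z z = 0.
Proof. exact: dot_Jrotid. Qed.

Lemma omegaDl u v w : omega (u + v) w = omega u w + omega v w.
Proof. by rewrite /omega JrotD dotDr. Qed.

Lemma omegaDr u v w : omega w (u + v) = omega w u + omega w v.
Proof. by rewrite /omega dotDl. Qed.

Lemma omegaZl a u v : omega (a *: u) v = a * omega u v.
Proof. by rewrite /omega JrotZ dotZr. Qed.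

Lemma omegaZr a u v : omega u (a *: v) = a * omega u v.
Proof. by rewrite /omega dotZl. Qed.

Lemma omegaNl u v : omega (- u) v = - omega u v.
Proof. by rewrite /omega JrotN dotNr. Qed.

Lemma omegaNr u v : omega u (- v) = - omega u v.
Proof. by rewrite /omega dotNl. Qed.

Lemma omega0l z : omega 0 z = 0.
Proof. by rewrite -(scale0r 0) omegaZl mul0r. Qed.

Definition dotE := (@dotDl, @dotDr, @dotNl, @dotNr, @dotZl, @dotZr).

End Symplectic.

(** * The profile functions of the Heisenberg distance *)

Section Profile.
Context {R : realType}.
Implicit Types x y m : R.

(** x cot x, continued by its limit at 0. *)
Definition xcot x : R := if x == 0 then 1 else x * cos x / sin x.

(** The ratio t / |z|^2 at the end (z, t) of a lifted arc of circle that starts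
    at 0 and turns by the angle 2 x. *)
Definition mu x : R :=
  if x == 0 then 0 else (x - sin x * cos x) / (2 * sin x ^+ 2).

Lemma sin_neq0 x : - pi < x < pi -> x != 0 -> sin x != 0.
Proof.
move=> /andP[x1 x2]; rewrite neq_lt => /orP[x0|x0].
- rewrite -oppr_eq0 -sinN gt_eqF// sin_gt0_pi//; lra.
- by rewrite gt_eqF// sin_gt0_pi// x0.
Qed.

(** Both sides are x^2 / sin^2 x, the squared ratio of the length of the arc of
    half-angle x to its chord; the right-hand side is Phi x at an end point of
    the arc (see Phi_mu). *)
Lemma xcot_mu x : - pi < x < pi ->
  xcot x ^+ 2 + x ^+ 2 = 2 * x * mu x + xcot x.
Proof.
move=> hx; rewrite /xcot /mu; case: eqVneq => [->|x0]; first by ring.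
have sx := sin_neq0 hx x0.
have cx : cos x ^+ 2 = 1 - sin x ^+ 2 by have := cos2Dsin2 x; lra.
by field: cx; rewrite sx.
Qed.

Lemma muN x : mu (- x) = - mu x.
Proof.
rewrite /mu oppr_eq0; case: eqVneq => [_|_]; first by rewrite oppr0.
by rewrite sinN cosN sqrrN -[RHS]mulNr; congr (_ / _); ring.
Qed.

Lemma x_cos_le_sin x : 0 <= x <= pi -> x * cos x <= sin x.
Proof.
move=> /andP[x0 xpi].
pose f := (fun y => sin y - y * cos y).
have df y : is_derive y 1 f (y * sin y).
  by apply: is_derive_eq; rewrite /GRing.scale/=; ring.
have : f 0 <= f x.
  apply: (@ger0_derive1_le_cc _ f 0 pi); rewrite ?in_itv/= ?lexx ?pi_ge0 ?x0//.
  - by move=> y; rewrite in_itv/= => /andP[y0 y1]; rewrite derive1E derive_val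
      mulr_ge0 ?(ltW y0)// sin_ge0_pi// !ltW.
  - apply/continuous_subspaceT => y; apply/differentiable_continuous.
    exact/derivable1_diffP.
by rewrite /f sin0 mul0r subrr; lra.
Qed.

Lemma mu_surj_pos m : 0 < m -> exists2 x, 0 < x < pi & mu x = m.
Proof.
move=> m0.
have pi0 := @pi_gt0 R.
pose f := (fun y => 2 * m * sin y ^+ 2 - (y - sin y * cos y)).
have df y : derivable f y 1 by apply: ex_derive.
(* mu x <= tan x / 2 for x < pi / 2, so atan m is below the solution. *)
pose x0 := atan m.
have x0m : tan x0 = m := atanK m.
have x01 : 0 < x0 by rewrite -(@atan0 R); exact: lt_atan.
have x02 : x0 < pi / 2 := atan_ltpi2 m.
have c0 : 0 < cos x0 by apply: cos_gt0_pihalf; lra.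
have s0 : 0 < sin x0 by apply: sin_gt0_pi; lra.
have fx0 : 0 <= f x0.
  have sE : sin x0 = m * cos x0 by rewrite -x0m /tan divfK// gt_eqF.
  have : x0 * cos x0 <= sin x0 by apply: x_cos_le_sin; lra.
  have c2 : sin x0 ^+ 2 = 1 - cos x0 ^+ 2 by have := cos2Dsin2 x0; lra.
  move=> h; have : x0 <= m.
    by rewrite -(ler_pM2r c0) -sE.
  have : sin x0 * cos x0 = m * (1 - sin x0 ^+ 2).
    by rewrite c2 {1}sE; ring.
  by have := sqr_ge0 (sin x0); rewrite /f; nra.
have [] := @IVT _ f x0 pi 0.
- by lra.
- apply/continuous_subspaceT => y; apply/differentiable_continuous.
  exact/derivable1_diffP.
- have fpi : f pi < 0 by rewrite /f sinpi; lra.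
  by rewrite ge_min le_max fx0 (ltW fpi) orbT.
move=> x; rewrite in_itv/= => /andP[x1 x2] fx.
have xpi : x < pi.
  rewrite lt_neqAle x2 andbT; apply/eqP => xE.
  by move: fx; rewrite xE /f sinpi; lra.
exists x; first by lra.
have sx : 0 < sin x by apply: sin_gt0_pi; lra.
rewrite /mu gt_eqF; last by lra.
have -> : x - sin x * cos x = 2 * m * sin x ^+ 2 by move: fx; rewrite /f; lra.
by field; rewrite gt_eqF.
Qed.

(** Every ratio t / |z|^2 is that of some arc of at most one turn. *)
Lemma mu_surj m : exists2 x, - pi < x < pi & mu x = m.
Proof.
have pi0 := @pi_gt0 R.
have [m0|m0|->] := ltgtP m 0.
- have [|x xpi xm] := @mu_surj_pos (- m); first by lra.
  by exists (- x); [lra|rewrite muN xm opprK].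
- by have [x xpi xm] := mu_surj_pos m0; exists x => //; lra.
- by exists 0; [lra|rewrite /mu eqxx].
Qed.

(** The solution of the Riccati equation K' = - (K^2 + b^2) that blows up at 0. *)
Definition ricc (b s : R) : R :=
  if b == 0 then s^-1 else b * cos (b * s) / sin (b * s).

Lemma ricc_xcot b s : s != 0 -> s * ricc b s = xcot (b * s).
Proof.
move=> s0; rewrite /ricc /xcot mulf_eq0 (negPf s0) orbF.
by case: eqVneq => _; [rewrite divff|rewrite !mulrA [s * b]mulrC].
Qed.

Lemma is_derive_ricc b s : 0 < s -> `|b| * s < pi ->
  is_derive s 1 (ricc b) (- (ricc b s ^+ 2 + b ^+ 2)).
Proof.
move=> s0 bs; have [->|b0] := eqVneq b 0.
  rewrite /ricc eqxx.
  have h : is_derive s 1 (id : R -> R) 1 by exact: is_derive_id.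
  have : is_derive s 1 (fun t : R => (id t)^-1) (- (id s) ^- 2 *: (1:R)).
    by apply: is_deriveV; rewrite gt_eqF.
  move=> h'; apply: (is_derive_eq h').
  by rewrite /GRing.scale/= -exprVn; ring.
have sb : sin (b * s) != 0.
  apply: sin_neq0; last by rewrite mulf_neq0// gt_eqF.
  by rewrite -ltr_norml normrM (gtr0_norm s0).
rewrite /ricc (negPf b0).
have h1 : is_derive s 1 (fun t : R => b * t) b.
  by apply: is_derive_eq; rewrite /GRing.scale/=; ring.
have h2 : is_derive s 1 (fun t : R => sin (b * t)) (cos (b * s) * b).
  by apply: is_derive1_comp.
have h3 : is_derive s 1 (fun t : R => cos (b * t)) (- sin (b * s) * b).
  by apply: is_derive1_comp.
have h4 : is_derive s 1 (fun t : R => (sin (b * t))^-1)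
   (- (sin (b * s)) ^- 2 *: (cos (b * s) * b)).
  exact: is_deriveV.
have h5 : is_derive s 1 (fun t : R => b * cos (b * t)) (b * (- sin (b * s) * b)).
  by apply: is_derive_eq; rewrite /GRing.scale/=; ring.
apply: (is_derive_eq (is_deriveM h5 h4)).
rewrite /GRing.scale/=.
have c2 : cos (b * s) ^+ 2 = 1 - sin (b * s) ^+ 2.
  by have := cos2Dsin2 (b * s); lra.
by field: c2; rewrite sb.
Qed.

End Profile.

(** * The calibration *)

Section Calibration.
Context {R : realType} {n : nat}.
Local Notation Z := ('rV[R]_n * 'rV[R]_n)%type.
Local Notation H := (heis R n).

Lemma is_derive_lin (V W : normedModType R) (L : V -> W) (h : R -> V) (s : R) dh :
    (forall a u v, L (a *: (u - v)) = a *: (L u - L v)) -> continuous L ->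
  is_derive s 1 h dh -> is_derive s 1 (L \o h) (L dh).
Proof.
move=> linL cL [dh1 dh2].
have lim : (fun k : R => L (k^-1 *: ((h \o shift s) (k *: 1) - h s))) @ 0^' -->
    L dh.
  apply: cvg_comp; last exact: cL.
  by rewrite -dh2; exact: dh1.
have {}lim : (fun k : R => k^-1 *: (((L \o h) \o shift s) (k *: 1) - (L \o h) s)) @ 0^' --> L dh.
  by under eq_fun do rewrite -linL.
split; first by apply/cvg_ex; exists (L dh).
exact: cvg_lim lim.
Qed.

Lemma continuous_xc i : continuous (fun p : H => p.1.1 0 i).
Proof.
move=> p; apply: (@continuous_comp _ _ _ (fun p : H => p.1.1) (fun v : 'rV[R]_n => v 0 i));
  last exact: coord_continuous.
apply: (@continuous_comp _ _ _ (fst : H -> Z) (fst : Z -> 'rV[R]_n)); exact: cvg_fst.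
Qed.

Lemma continuous_yc i : continuous (fun p : H => p.1.2 0 i).
Proof.
move=> p; apply: (@continuous_comp _ _ _ (fun p : H => p.1.2) (fun v : 'rV[R]_n => v 0 i));
  last exact: coord_continuous.
apply: (@continuous_comp _ _ _ (fst : H -> Z) (snd : Z -> 'rV[R]_n)).
  exact: cvg_fst.
exact: cvg_snd.
Qed.

Lemma continuous_tc : continuous (fun p : H => p.2).
Proof. by move=> p; exact: cvg_snd. Qed.

Lemma cvg_dot (T : Type) (F : set_system T) {FF : Filter F}
    (f g : T -> H) (p q : H) :
  f x @[x --> F] --> p -> g x @[x --> F] --> q ->
  (fun x => dot (f x).1 (g x).1) @ F --> (dot p.1 q.1 : R).
Proof.
move=> fp gq; rewrite /dot; elim: (index_enum _) => [|i r ih].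
  by under eq_fun do rewrite big_nil; rewrite big_nil; exact: cvg_cst.
under eq_fun do rewrite big_cons; rewrite big_cons; apply: cvgD => {ih}//.
apply: cvgD; apply: cvgM.
- exact: (@cvg_comp _ _ _ f (fun v : H => v.1.1 0 i) _ _ _ fp (@continuous_xc i p)).
- exact: (@cvg_comp _ _ _ g (fun v : H => v.1.1 0 i) _ _ _ gq (@continuous_xc i q)).
- exact: (@cvg_comp _ _ _ f (fun v : H => v.1.2 0 i) _ _ _ fp (@continuous_yc i p)).
- exact: (@cvg_comp _ _ _ g (fun v : H => v.1.2 0 i) _ _ _ gq (@continuous_yc i q)).
Qed.

Lemma is_derive_dot (f g : R -> H) (s : R) df dg :
  is_derive s 1 f df -> is_derive s 1 g dg ->
  is_derive s 1 (fun r => dot (f r).1 (g r).1) (dot df.1 (g s).1 + dot (f s).1 dg.1).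
Proof.
move=> hf hg.
have h1 (k : R -> H) dk i : is_derive s 1 k dk ->
    is_derive s 1 (fun r => (k r).1.1 0 i) (dk.1.1 0 i).
  move=> hk; apply: (is_derive_lin (L := fun p : H => p.1.1 0 i)) hk.
    by move=> a u v; rewrite !mxE.
  exact: continuous_xc.
have h2 (k : R -> H) dk i : is_derive s 1 k dk ->
    is_derive s 1 (fun r => (k r).1.2 0 i) (dk.1.2 0 i).
  move=> hk; apply: (is_derive_lin (L := fun p : H => p.1.2 0 i)) hk.
    by move=> a u v; rewrite !mxE.
  exact: continuous_yc.
have -> : (fun r => dot (f r).1 (g r).1) = \sum_i
    (fun r => (f r).1.1 0 i * (g r).1.1 0 i + (f r).1.2 0 i * (g r).1.2 0 i).
  by apply/funext => r; rewrite fct_sumE.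
have -> : dot df.1 (g s).1 + dot (f s).1 dg.1 = \sum_i
   (df.1.1 0 i * (g s).1.1 0 i + (f s).1.1 0 i * dg.1.1 0 i +
   (df.1.2 0 i * (g s).1.2 0 i + (f s).1.2 0 i * dg.1.2 0 i)).
  by rewrite /dot -big_split/=; apply: eq_bigr => i _; ring.
apply: is_derive_sum => i.
have := h1 _ _ i hf; have := h1 _ _ i hg; have := h2 _ _ i hf; have := h2 _ _ i hg.
move=> k1 k2 k3 k4.
apply: is_derive_eq.
rewrite /GRing.scale/=; ring.
Qed.

Lemma is_derive_snd (f : R -> H) (s : R) df :
  is_derive s 1 f df -> is_derive s 1 (fun r => (f r).2) df.2.
Proof.
apply: (is_derive_lin (L := fun p : H => p.2)) => //.
exact: continuous_tc.
Qed.

(** The horizontal and vertical coordinates of p^-1 q. *)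
Definition relz (p q : H) : Z := q.1 - p.1.
Definition relt (p q : H) : R := q.2 - p.2 - omega p.1 q.1.

(** For fixed p and b, the function psi b s p q - s of (s, q) calibrates the
    horizontal curves parametrized by their length s. At b = x / s it is
    (Phi x - s^2) / s. *)
Definition psi (b s : R) (p q : H) : R :=
  2 * b * relt p q + ricc b s * dot (relz p q) (relz p q).

Lemma is_derive_psi (h : R -> H) (I : R -> R) (b s : R) p dh dI :
    0 < I s -> `|b| * I s < pi -> is_derive s 1 h dh -> is_derive s 1 I dI ->
  is_derive s 1 (fun r => psi b (I r) p (h r))
    (2 * b * (dh.2 - omega p.1 dh.1) + 2 * ricc b (I s) * dot dh.1 (relz p (h s))
     - dI * (b ^+ 2 + ricc b (I s) ^+ 2) * dot (relz p (h s)) (relz p (h s))).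
Proof.
move=> I0 Ipi hh hI.
have h1 : is_derive s 1 (fun r => h r - p) dh.
  by apply: is_derive_eq; rewrite subr0.
have h2 : is_derive s 1 (fun r => dot (relz p (h r)) (relz p (h r)))
  (dot dh.1 (relz p (h s)) + dot (relz p (h s)) dh.1) := is_derive_dot h1 h1.
have h3 := is_derive_snd hh.
have h4 := is_derive_dot hh (is_derive_cst ((Jrot p.1, 0) : H) s 1).
have h5 : is_derive s 1 (fun r => ricc b (I r))
   (- (ricc b (I s) ^+ 2 + b ^+ 2) * dI).
  by apply: (@is_derive1_comp _ (ricc b)); exact: is_derive_ricc.
have h6 : is_derive s 1 (fun r => relt p (h r)) (dh.2 - omega p.1 dh.1).
  by apply: is_derive_eq; rewrite /= dot0r /omega; ring.
have h7 := is_deriveM h5 h2.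
rewrite /psi; apply: is_derive_eq.
rewrite [dot (relz _ _) dh.1]dotC /GRing.scale/=; ring.
Qed.

(** The Riccati equation makes the derivative of psi b (s + I) p h equal to
    2 <h', Y> - I' |Y|^2 with Y = b J z + ricc z, where z is the horizontal part
    of p^-1 h; as I' = |h'|, it is at most I' by completing the square. *)
Lemma psi_piece (h dh : R -> H) (I : R -> R) (u v b s : R) p :
    u <= v -> 0 < s -> `|b| * (s + I v) < pi -> I u = 0 ->
    (forall r, r \in `[u, v] -> is_derive r 1 h (dh r)) ->
    (forall r, r \in `]u, v[ -> (dh r).2 = omega (h r).1 (dh r).1) ->
    (forall r, r \in `[u, v] ->
      is_derive r 1 I (Num.sqrt (dot (dh r).1 (dh r).1))) ->
  psi b (s + I v) p (h v) <= psi b s p (h u) + I v.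
Proof.
move=> uv s0 bs Iu hh hor hI.
have cI : {within `[u, v], continuous I}.
  by apply: derivable_within_continuous => r /hI[].
have Imono x y : x \in `[u, v] -> y \in `[u, v] -> x <= y -> I x <= I y.
  move=> xuv yuv; apply: (@ger0_derive1_le_cc _ I u v) => // r ruv;
    have [] := hI r (subset_itv_oo_cc ruv) => // d1 d2.
  by rewrite derive1E d2 sqrtr_ge0.
have uuv : u \in `[u, v] by rewrite in_itv/= lexx.
have vuv : v \in `[u, v] by rewrite in_itv/= lexx uv.
have Ipos r : r \in `[u, v] -> 0 < s + I r.
  move=> ruv; have : I u <= I r.
    by apply: Imono => //; move: ruv; rewrite in_itv => /andP[].
  by rewrite Iu; lra.
have Ipi r : r \in `[u, v] -> `|b| * (s + I r) < pi.
  move=> ruv; apply: le_lt_trans bs; apply: ler_wpM2l => //.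
  by rewrite lerD2l; apply: Imono => //; move: ruv; rewrite in_itv => /andP[].
pose G r := psi b (s + I r) p (h r) - I r.
have dG r : r \in `[u, v] -> is_derive r 1 G
    (2 * b * ((dh r).2 - omega p.1 (dh r).1) +
     2 * ricc b (s + I r) * dot (dh r).1 (relz p (h r)) -
     Num.sqrt (dot (dh r).1 (dh r).1) * (b ^+ 2 + ricc b (s + I r) ^+ 2)
       * dot (relz p (h r)) (relz p (h r)) -
     Num.sqrt (dot (dh r).1 (dh r).1)).
  move=> ruv; have hr := hh r ruv; have Ir := hI r ruv.
  have Ir' : is_derive r 1 (fun r => s + I r) (Num.sqrt (dot (dh r).1 (dh r).1)).
    by have := is_deriveD (is_derive_cst (s : R) r (1 : R)) Ir; rewrite add0r.
  have := @is_derive_psi h (fun r => s + I r) b r p _ _ (Ipos r ruv) (Ipi r ruv) hr Ir'.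
  by move=> k; exact: (is_deriveB k Ir).
have : G v <= G u.
  apply: (@ler0_derive1_le_cc _ G u v); [| | |exact: vuv|exact: uuv|exact: uv].
  - by move=> r /subset_itv_oo_cc/dG[].
  - move=> r ruv; have ruv' := subset_itv_oo_cc ruv.
    have [_ d2] := dG r ruv'.
    rewrite derive1E d2 (hor r ruv).
    set sp := Num.sqrt _; set z := relz p _; set w := (dh r).1.
    set K := ricc _ _.
    have -> : omega (h r).1 w - omega p.1 w = dot w (Jrot z).
      by rewrite /z /relz JrotD JrotN dotDr dotNr.
    clearbody z; have sp0 : 0 <= sp := sqrtr_ge0 _.
    have spE : dot w w = sp ^+ 2 by rewrite sqr_sqrtr// dot_ge0.
    have [sp00|sp_neq0] := eqVneq sp 0.
      have w0 : w = 0 by apply/eqP; rewrite -dot_eq0 spE sp00 expr0n.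
      by rewrite w0 !dot0l sp00; lra.
    have {}sp0 : 0 < sp by rewrite lt_def sp_neq0.
    (* The square to complete, multiplied by sp^2 to avoid a division. *)
    have := dot_ge0 (w - sp *: (b *: Jrot z + K *: z)).
    rewrite !(dotDl, dotDr, dotNl, dotNr, dotZl, dotZr) dot_Jrot dot_Jrotl
      dot_Jrotid spE [dot (Jrot z) w]dotC [dot z w]dotC => h'.
    rewrite -(ler_pM2l sp0); nra.
  - by apply: derivable_within_continuous => r /dG[].
by rewrite /G Iu addr0; lra.
Qed.

End Calibration.

(** * Lengths of horizontal curves *)

Section CurveCalibration.
Context {R : realType} {n : nat}.
Local Notation Z := ('rV[R]_n * 'rV[R]_n)%type.
Local Notation H := (heis R n).
Local Notation leb := (@lebesgue_measure R).

Lemma TcompE (p v : H) : Tcomp p v = v.2 - omega p.1 v.1.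
Proof.
rewrite /Tcomp; congr (_ - _); apply: eq_bigr => i _.
by rewrite /= mxE mulrN.
Qed.

Lemma metricE (p v w : H) : metric p v w = dot v.1 w.1 + Tcomp p v * Tcomp p w.
Proof. by []. Qed.

Lemma horizontalP (p v : H) : horizontal p v <-> v.2 = omega p.1 v.1.
Proof.
have TD (u w : H) : Tcomp p (u + w) = Tcomp p u + Tcomp p w.
  by rewrite !TcompE omegaDr /=; ring.
have TZ a (w : H) : Tcomp p (a *: w) = a * Tcomp p w.
  by rewrite !TcompE omegaZr /= /GRing.scale/=; ring.
have T0 : Tcomp p 0 = 0 by rewrite -(scale0r 0) TZ mul0r.
suff -> : horizontal p v <-> Tcomp p v = 0 by rewrite TcompE; split => [|->]; lra.
split=> [[a [b ->]]|Tv].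
  rewrite TD !(big_morph _ TD T0) !big1 ?addr0// => i _.
  - by rewrite TZ Tcomp_vfY mulr0.
  - by rewrite TZ Tcomp_vfX mulr0.
exists (xc v), (yc v); rewrite {1}(frame_decomposition p v).
by rewrite Tv scale0r addr0.
Qed.

Definition speed (g : R -> H) (s : R) : R :=
  Num.sqrt (metric (g s) (g^`()%classic s) (g^`()%classic s)).

Lemma antiderivative (f : R -> R) (u v : R) : continuous f -> u < v ->
  exists I : R -> R, [/\ I u = 0,
    (forall r, r \in `[u, v] -> is_derive r 1 I (f r)) &
    (\int[leb]_(r in `[u, v]) (f r)%:E = (I v)%:E)%E].
Proof.
move=> cf uv.
pose F x := (\int[leb]_(t in `[(u - 1)%R, x]) f t)%R.
have dF r : r \in `[u, v] -> is_derive r 1 F (f r).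
  rewrite in_itv/= => /andP[ur rv].
  have rv1 : r < v + 1 by lra.
  have fi : leb.-integrable `[u - 1, v + 1] (EFin \o f).
    apply: continuous_compact_integrable; first exact: segment_compact.
    exact: continuous_subspaceT.
  have ur1 : u - 1 < r by lra.
  have [h1 h2] := continuous_FTC1_closed rv1 fi ur1 (cf r).
  by split; [exact: h1|rewrite -derive1E h2].
have dI r : r \in `[u, v] -> is_derive r 1 (fun r => F r - F u) (f r).
  by move=> /dF h; apply: is_derive_eq; rewrite subr0.
exists (fun r => F r - F u); split => //; first by rewrite subrr.
rewrite (@continuous_FTC2 _ f (fun r => F r - F u) u v) ?subrr ?sube0//.
- exact: continuous_subspaceT.
- have cI r : r \in `[u, v] -> {for r, continuous (fun r => F r - F u)}.
    move=> /dI[h _]; apply: differentiable_continuous; exact/derivable1_diffP.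
  split.
  + by move=> r ruv; have [] := dI r (subset_itv_oo_cc ruv).
  + by apply: cvg_at_right_filter; apply: cI; rewrite in_itv/= lexx ltW.
  + by apply: cvg_at_left_filter; apply: cI; rewrite in_itv/= lexx ltW.
- by move=> r ruv; rewrite derive1E; have [] := dI r (subset_itv_oo_cc ruv).
Qed.

(** The velocity of g is meaningful inside the piece only; the smooth extension
    h replaces g up to the end points. *)
Lemma speed_piece (g : R -> H) (u v : R) : u < v -> smooth_on u v g ->
  {in `]u, v[, forall r, horizontal (g r) (g^`()%classic r)} ->
  exists h : R -> H, [/\ {in `[u, v], g =1 h},
    forall r : R, is_derive r 1 h (h^`()%classic r),
    continuous (fun r => Num.sqrt (dot (h^`()%classic r).1 (h^`()%classic r).1)),
    {in `]u, v[, forall r, (h^`()%classic r).2 = omega (h r).1 (h^`()%classic r).1} &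
    {in `]u, v[, forall r, speed g r =
       Num.sqrt (dot (h^`()%classic r).1 (h^`()%classic r).1)}].
Proof.
move=> uv [h sh gh] hor.
have ghr r : r \in `]u, v[ -> g^`()%classic r = h^`()%classic r.
  move=> ruv; rewrite !derive1E; apply: near_eq_derive.
  have := @near_in_itvoo R u v r ruv.
  by apply: filterS => x xuv; apply: gh; exact: subset_itv_oo_cc.
have hor' r : r \in `]u, v[ ->
    (h^`()%classic r).2 = omega (h r).1 (h^`()%classic r).1.
  move=> ruv; have /horizontalP := hor r ruv.
  by rewrite ghr// gh//; exact: subset_itv_oo_cc.
exists h; split; [exact: gh| | |exact: hor'|].
- by move=> r; rewrite derive1E; apply: derivableP; exact: (sh 0%N).
- move=> r; apply: (@continuous_comp _ _ _
      (fun r => dot (h^`()%classic r).1 (h^`()%classic r).1) Num.sqrt);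
    last exact: sqrt_continuous.
  have ch : h^`()%classic x @[x --> r] --> h^`()%classic r.
    by apply: differentiable_continuous; apply/derivable1_diffP; exact: (sh 1%N).
  exact: (@cvg_dot _ _ _ _ _ (h^`()%classic) (h^`()%classic) _ _ ch ch).
- move=> r ruv; rewrite /speed metricE TcompE ghr// gh//; last first.
    exact: subset_itv_oo_cc.
  by rewrite hor'// subrr mul0r addr0.
Qed.

Lemma curve_piece (g : R -> H) (u v : R) : u < v -> smooth_on u v g ->
  {in `]u, v[, forall r, horizontal (g r) (g^`()%classic r)} ->
  measurable_fun `[u, v] (speed g) /\
  exists l : R, [/\ 0 <= l, (\int[leb]_(r in `[u, v]) (speed g r)%:E)%E = l%:E &
    forall (b s : R) p, 0 < s -> `|b| * (s + l) < pi ->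
      psi b (s + l) p (g v) <= psi b s p (g u) + l].
Proof.
move=> uv sm hor; have [h [gh dh cs hor' sp]] := speed_piece uv sm hor.
have [I [Iu dI intI]] := antiderivative cs uv.
have msp : measurable_fun `]u, v[ (speed g).
  apply: (eq_measurable_fun
      (fun r => Num.sqrt (dot (h^`()%classic r).1 (h^`()%classic r).1))).
    by move=> r; rewrite inE/= => /sp.
  by apply: subspace_continuous_measurable_fun => //; exact: continuous_subspaceT.
have mspc := measurable_fun_itv_cc msp.
have intE : (\int[leb]_(r in `[u, v]) (speed g r)%:E)%E = (I v)%:E.
  rewrite -intI; apply: eq_integral_itv_bounded => //.
  by apply: subspace_continuous_measurable_fun => //; exact: continuous_subspaceT.
split => //; exists (I v); split => //.
  rewrite -lee_fin -intE; apply: integral_ge0 => r _.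
  by rewrite lee_fin sqrtr_ge0.
move=> b s p s0 bs.
rewrite !gh ?in_itv/= ?lexx ?(ltW uv)//.
apply: (@psi_piece _ _ h (h^`()%classic)) => //; exact: ltW.
Qed.

(** The inequality of one piece has the form of a telescoping sum: the length
    of the previous pieces is absorbed in s. *)
Lemma curve_calibration (g : R -> H) (a c : R) : horizontal_curve a c g ->
  exists l : R, [/\ 0 <= l, curve_length a c g = l%:E &
    forall (b s : R) p, 0 < s -> `|b| * (s + l) < pi ->
      psi b (s + l) p (g c) <= psi b s p (g a) + l].
Proof.
move=> [s sac hs].
suff [_ []] : measurable_fun `[a, c] (speed g) /\
  exists l : R, [/\ 0 <= l, (\int[leb]_(r in `[a, c]) (speed g r)%:E)%E = l%:E &
    forall (b s : R) p, 0 < s -> `|b| * (s + l) < pi ->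
      psi b (s + l) p (g c) <= psi b s p (g a) + l].
  by move=> l []; exists l.
elim: s a sac hs => [a /itv_partition_nil -> _|x s ih a sac hs].
  rewrite set_itv1; split; first exact: measurable_fun_set1.
  exists 0; split => //; first by rewrite integral_set1.
  by move=> b s p _ _; rewrite !addr0.
have ax : a < x by case: sac => /= /andP[].
have [smx horx] := hs 0%N isT.
have sxc := itv_partition_cons sac.
have xc := itv_partition_le sxc.
have {}[m2 [l2 [l20 l2E cal2]]] := ih _ sxc (fun k => hs k.+1).
have [m1 [l1 [l10 l1E cal1]]] := curve_piece ax smx horx.
have acU : `[a, c]%classic = `[a, x]%classic `|` `]x, c]%classic.
  by apply: itv_bndbnd_setU; rewrite bnd_simp// ltW.
have m2o : measurable_fun `]x, c] (speed g).
  by apply: measurable_funS m2 => //; exact: subset_itv_oc_cc.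
have mac : measurable_fun `[a, c] (speed g).
  by rewrite acU; apply/measurable_funU.
split => //; exists (l1 + l2); split; first exact: addr_ge0.
  rewrite acU ge0_integral_setU//=.
  - rewrite l1E integral_itv_obnd_cbnd; last exact/measurable_EFinP.
    by rewrite l2E EFinD.
  - by rewrite -acU; exact/measurable_EFinP.
  - by move=> r _; rewrite lee_fin sqrtr_ge0.
  - apply/disj_setPS => r [/=]; rewrite !in_itv/= => /andP[_ rx] /andP[xr _].
    by move: (lt_le_trans xr rx); rewrite ltxx.
move=> b t p t0 bt.
rewrite !addrA; apply: le_trans (cal2 _ _ _ _ _) _.
- by lra.
- by move: bt; rewrite addrA.
- rewrite lerD2r; apply: cal1 => //; apply: le_lt_trans bt.
  by apply: ler_wpM2l => //; lra.
Qed.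

End CurveCalibration.

(** * Arcs of circles and segments *)

Section Arcs.
Context {R : realType} {n : nat}.
Local Notation Z := ('rV[R]_n * 'rV[R]_n)%type.
Local Notation H := (heis R n).

(** The span of 1, s, sin (k s) and cos (k s) contains the lifts of segments and
    of circles and is stable under differentiation, so that its elements are
    smooth. *)
Definition trig (k : R) (V0 V1 V2 V3 : H) (s : R) : H :=
  V0 + s *: V1 + sin (k * s) *: V2 + cos (k * s) *: V3.

Lemma is_derive_trig k V0 V1 V2 V3 (s : R) :
  is_derive s 1 (trig k V0 V1 V2 V3) (trig k V1 0 (- k *: V3) (k *: V2) s).
Proof.
have sc (f : R -> R) df (V : H) : is_derive s 1 f df ->
    is_derive s 1 (fun r => f r *: V) (df *: V).
  move=> hf; apply: (is_derive_lin (L := fun r : R => r *: V)) hf.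
    by move=> a u v; rewrite -scalerBl scalerA.
  exact: scalel_continuous.
have h1 : is_derive s 1 (fun t : R => k * t) k.
  by apply: is_derive_eq; rewrite /GRing.scale/=; ring.
have h2 : is_derive s 1 (fun t : R => sin (k * t)) (cos (k * s) * k).
  by apply: is_derive1_comp.
have h3 : is_derive s 1 (fun t : R => cos (k * t)) (- sin (k * s) * k).
  by apply: is_derive1_comp.
have := is_deriveD (is_deriveD (is_deriveD (is_derive_cst V0 s 1)
  (sc _ _ V1 (is_derive_id s 1))) (sc _ _ V2 h2)) (sc _ _ V3 h3).
move=> h; apply: (is_derive_eq h).
rewrite /trig !scalerA add0r scale1r scaler0 addr0 addrAC.
by rewrite mulNr -mulrN.
Qed.

Lemma derive_trig k V0 V1 V2 V3 :
  (trig k V0 V1 V2 V3)^`()%classic = trig k V1 0 (- k *: V3) (k *: V2).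
Proof.
apply/funext => s; rewrite derive1E.
by have [] := is_derive_trig k V0 V1 V2 V3 s.
Qed.

Lemma smooth_trig k V0 V1 V2 V3 : smooth (trig k V0 V1 V2 V3).
Proof.
move=> m s; elim: m V0 V1 V2 V3 => [|m ih] V0 V1 V2 V3.
  by have [] := is_derive_trig k V0 V1 V2 V3 s.
by rewrite derive1Sn derive_trig.
Qed.

Lemma trig_length k V0 V1 V2 V3 c (g := trig k V0 V1 V2 V3)
    (dg := trig k V1 0 (- k *: V3) (k *: V2)) : 0 <= c ->
  (forall s, (dg s).2 = omega (g s).1 (dg s).1) ->
  (forall s, dot (dg s).1 (dg s).1 = c ^+ 2) ->
  horizontal_curve 0 1 g /\ curve_length 0 1 g = c%:E.
Proof.
move=> c0 hor cs; split.
  exists [:: 1]; first by apply: itv_partition1; exact: ltr01.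
  move=> [|//] _ /=; split; first by exists g => //; exact: smooth_trig.
  by move=> r _; apply/horizontalP; rewrite derive_trig; exact: hor.
rewrite /curve_length.
under eq_integral => s _.
  rewrite metricE TcompE derive_trig -/dg -/g hor subrr mul0r addr0 cs.
  rewrite sqrtr_sqr ger0_norm//.
  over.
by rewrite integral_cst//= lebesgue_measure_itv/= lte_fin ltr01 sube0 mule1.
Qed.

(** The left translate by p of the lift of the circle arc
    (1 - cos (k s)) A + sin (k s) B, which starts at 0. *)
Definition circ (p : H) (A B : Z) (k : R) : R -> H :=
  trig k (p.1 + A, p.2 + omega p.1 A) (0, - k * omega A B)
    (B, omega p.1 B + omega A B) (- A, - omega p.1 A).

Lemma circ_length p A B k : dot A A = dot B B -> dot A B = 0 ->
  horizontal_curve 0 1 (circ p A B k) /\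
  curve_length 0 1 (circ p A B k) = (Num.sqrt (k ^+ 2 * dot B B))%:E.
Proof.
move=> AB AB0; apply: trig_length; first exact: sqrtr_ge0.
- move=> s; rewrite /trig /= !(scaler0, addr0, add0r).
  have c2 : cos (k * s) ^+ 2 = 1 - sin (k * s) ^+ 2.
    by have := cos2Dsin2 (k * s); lra.
  move: (sin (k * s)) (cos (k * s)) c2 => a b c2.
  rewrite !(scalerN, scaleNr, opprK).
  rewrite !(omegaDl, omegaDr, omegaNl, omegaNr, omegaZl, omegaZr) !omega_id.
  by rewrite [omega B A]omegaC /GRing.scale/=; ring: c2.
- move=> s; rewrite /trig /= !(scaler0, addr0, add0r).
  rewrite sqr_sqrtr; last by rewrite mulr_ge0 ?sqr_ge0 ?dot_ge0.
  have c2 : cos (k * s) ^+ 2 = 1 - sin (k * s) ^+ 2.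
    by have := cos2Dsin2 (k * s); lra.
  move: (sin (k * s)) (cos (k * s)) c2 => a b c2.
  rewrite !(scalerN, scaleNr, opprK).
  rewrite !(dotDl, dotDr, dotNl, dotNr, dotZl, dotZr) [dot B A]dotC AB0 AB.
  by ring: c2.
Qed.

Lemma circ0 p A B k : circ p A B k 0 = p.
Proof.
rewrite /circ /trig mulr0 sin0 cos0 !scale0r scale1r !addr0.
by case: p => p1 p2; congr pair; rewrite /= addrK.
Qed.

Lemma circ1 p A B k : circ p A B k 1 =
  (p.1 + (A - cos k *: A + sin k *: B),
   p.2 + omega p.1 (A - cos k *: A + sin k *: B) + omega A B * (sin k - k)).
Proof.
rewrite /circ /trig mulr1 scale1r; congr pair => /=.
  by rewrite scalerN addr0 !addrA -[RHS]addrA [- _ + _]addrC !addrA.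
rewrite /GRing.scale/= !(omegaDr, omegaNr, omegaZr); ring.
Qed.

Definition seg (p : H) (C : Z) : R -> H :=
  trig 0 p (C, omega p.1 C) 0 0.

Lemma seg_length p C : horizontal_curve 0 1 (seg p C) /\
  curve_length 0 1 (seg p C) = (Num.sqrt (dot C C))%:E.
Proof.
apply: trig_length; first exact: sqrtr_ge0.
- move=> s; rewrite /trig /= !(scaler0, addr0) omegaDl omegaZl omega_id.
  by rewrite mulr0 addr0.
- move=> s; rewrite /trig /= !(scaler0, addr0).
  by rewrite sqr_sqrtr// dot_ge0.
Qed.

Lemma seg0 p C : seg p C 0 = p.
Proof. by rewrite /seg /trig scale0r !scaler0 !addr0. Qed.

Lemma seg1 p C : seg p C 1 = (p.1 + C, p.2 + omega p.1 C).
Proof. by rewrite /seg /trig scale1r !scaler0 !addr0. Qed.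

End Arcs.

(** * The distance in closed form *)

Section Distance.
Context {R : realType} {n : nat}.
Local Notation Z := ('rV[R]_n * 'rV[R]_n)%type.
Local Notation H := (heis R n).
Implicit Types (p q r : H) (x l : R).

Definition Phi x (z : Z) (t : R) : R := 2 * x * t + xcot x * dot z z.

Definition joined p q l := 0 <= l /\ exists g : R -> H,
  [/\ horizontal_curve 0 1 g, g 0 = p, g 1 = q & curve_length 0 1 g = l%:E].

Lemma psi_self b s p : psi b s p p = 0.
Proof.
by rewrite /psi /relt /relz omega_id !subrr dot0l !mulr0 addr0.
Qed.

(** The calibration based at the start of the curve, at time eta: there psi
    vanishes although ricc has a pole at 0. The parameter b is chosen so that
    the final time eta + l corresponds to the angle x, and eta tends to 0. *)
Lemma Phi_le_length a c (g : R -> H) x : horizontal_curve a c g -> - pi < x < pi ->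
  exists l, [/\ 0 <= l, curve_length a c g = l%:E &
    Phi x (relz (g a) (g c)) (relt (g a) (g c)) <= l ^+ 2].
Proof.
move=> hg xpi; have [l [l0 lE cal]] := curve_calibration hg.
exists l; split => //.
apply/ler_addgt0Pr => e e0.
pose eta := e / (l + 1).
have eta0 : 0 < eta by rewrite divr_gt0//; lra.
have el0 : 0 < eta + l by lra.
have etal : eta * l <= e.
  by rewrite /eta mulrAC ler_pdivrMr; [nra|lra].
have := cal (x / (eta + l)) eta (g a) eta0.
rewrite psi_self add0r normrM normfV (gtr0_norm el0) divfK ?gt_eqF//.
rewrite ltr_norml => /(_ xpi).
rewrite /psi -(ler_pM2l el0) mulrDr !mulrA ricc_xcot ?gt_eqF//.
rewrite divfK ?gt_eqF// => h.
rewrite /Phi.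
have -> : 2 * x * relt (g a) (g c) =
   (eta + l) * 2 * x / (eta + l) * relt (g a) (g c).
  by field; rewrite gt_eqF.
apply: le_trans h _; by rewrite expr2 mulrDl addrC lerD2l.
Qed.

(** The arc of circle with end points 0 and relz p q and half-angle x. Its
    vertical coordinate is the right one by the definition of mu. *)
Lemma geodesic_nonvertical p q x : relz p q != 0 -> - pi < x < pi ->
    relt p q = mu x * dot (relz p q) (relz p q) ->
  joined p q (Num.sqrt ((xcot x ^+ 2 + x ^+ 2) * dot (relz p q) (relz p q))).
Proof.
move=> z0 xpi tE; split; first exact: sqrtr_ge0.
have qE1 : q.1 = p.1 + relz p q by rewrite /relz addrC subrK.
have qE2 : q.2 = p.2 + omega p.1 (relz p q) + relt p q.
  by rewrite /relt /relz omegaDr omegaNr omega_id; ring.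
move: tE; rewrite /mu /xcot; have [x0|x0] := eqVneq x 0 => tE.
  rewrite x0 expr0n addr0 expr1n mul1r.
  exists (seg p (relz p q)); have [h1 h2] := seg_length p (relz p q).
  split => //; first exact: seg0.
  by rewrite seg1 -qE1; move: qE2; rewrite tE mul0r addr0 => <-; case: (q).
have sx := sin_neq0 xpi x0.
have c2 : cos x ^+ 2 = 1 - sin x ^+ 2 by have := cos2Dsin2 x; lra.
set z := relz p q in z0 tE qE1 qE2 *.
clearbody z.
(* The arc ends at 2 sin x (sin x A + cos x B), and B = J A up to sign. *)
pose A := (2 * sin x)^-1 *: (sin x *: z + cos x *: Jrot z).
pose B := (2 * sin x)^-1 *: (cos x *: z - sin x *: Jrot z).
have AA : dot A A = dot z z / (4 * sin x ^+ 2).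
  rewrite /A !dotE dot_Jrot dot_Jrotid dot_Jrotl.
  by field: c2; rewrite sx.
have BB : dot B B = dot z z / (4 * sin x ^+ 2).
  rewrite /B !dotE dot_Jrot dot_Jrotid dot_Jrotl.
  by field: c2; rewrite sx.
have AB : dot A B = 0.
  rewrite /A /B !dotE dot_Jrot dot_Jrotid dot_Jrotl.
  by field: c2; rewrite sx.
have oAB : omega A B = - dot z z / (4 * sin x ^+ 2).
  rewrite /omega /A /B JrotZ JrotD !JrotZ JrotK !dotE dot_Jrot dot_Jrotid dot_Jrotl.
  by field: c2; rewrite sx.
have s2 : sin (2 * x) = 2 * sin x * cos x.
  by rewrite mulrC mulr_natr sin_mulr2n; ring.
have c2x : cos (2 * x) = 2 * cos x ^+ 2 - 1.
  by rewrite mulrC mulr_natr cos_mulr2n; ring.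
exists (circ p A B (2 * x)).
have [h1 h2] := circ_length p (2 * x) (etrans AA (esym BB)) AB.
split => //; first exact: circ0.
- rewrite circ1.
  have -> : A - cos (2 * x) *: A + sin (2 * x) *: B = z.
    rewrite -{1}[A]scale1r -scalerBl /A /B !scalerA !scalerDr !scalerN !scalerA.
    rewrite addrACA -scalerBl -scalerDl s2 c2x.
    have -> : (1 - (2 * cos x ^+ 2 - 1)) / (2 * sin x) * sin x +
      2 * sin x * cos x / (2 * sin x) * cos x = 1.
      by field: c2; rewrite sx.
    have -> : (1 - (2 * cos x ^+ 2 - 1)) / (2 * sin x) * cos x -
      2 * sin x * cos x / (2 * sin x) * sin x = 0.
      by field: c2; rewrite sx.
    by rewrite scale1r scale0r addr0.
  rewrite -qE1; rewrite tE in qE2; case: (q) qE2 => q1 q2 /= ->.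
  by congr pair; congr (_ + _); rewrite oAB s2; field; rewrite sx.
- rewrite h2; congr (EFin (Num.sqrt _)); rewrite BB.
  by field: c2; rewrite sx.
Qed.

(** A full circle in the plane of x_1 and y_1, of area |t| / 2; its orientation
    is that of the sign of t. *)
Lemma geodesic_vertical p q : (1 <= n)%N -> relz p q = 0 ->
  joined p q (Num.sqrt (2 * pi * `|relt p q|)).
Proof.
move=> n_ge1 z0; split; first exact: sqrtr_ge0.
have qE1 : q.1 = p.1 by apply/eqP; rewrite -subr_eq0; exact/eqP.
have qE2 : q.2 = p.2 + relt p q by rewrite /relt qE1 omega_id; ring.
have pi0 := @pi_gt0 R.
pose c : R := Num.sqrt (`|relt p q| / (2 * pi)).
have c2 : c ^+ 2 = `|relt p q| / (2 * pi).
  by rewrite sqr_sqrtr// divr_ge0//; lra.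
pose i0 : 'I_n := Ordinal n_ge1.
pose B : Z := (c *: delta_mx 0 i0, 0).
have BB : dot B B = c ^+ 2.
  rewrite /dot (bigD1 i0)//= big1 ?addr0 => [|i ii0]; rewrite !mxE ?eqxx.
    by rewrite !(mulr1, mulr0) addr0 expr2.
  by rewrite (negbTE ii0) andbF !mulr0 addr0.
pose e : R := if 0 <= relt p q then 1 else -1.
have eE : e * `|relt p q| = relt p q.
  by rewrite /e; case: ger0P => _; ring.
have e2 : e * e = 1 by rewrite /e; case: ifP => _; ring.
pose A := e *: Jrot B.
have AA : dot A A = dot B B by rewrite /A !dotE mulrA e2 mul1r dot_Jrot.
have AB : dot A B = 0 by rewrite /A !dotE dot_Jrotl mulr0.
have oAB : omega A B = - e * c ^+ 2.
  by rewrite /omega /A JrotZ JrotK !dotE BB; ring.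
exists (circ p A B (2 * pi)).
have [h1 h2] := circ_length p (2 * pi) AA AB.
have s2 : sin (2 * pi) = 0 :> R by rewrite mulrC mulr_natr sin2pi.
have c2p : cos (2 * pi) = 1 :> R by rewrite mulrC mulr_natr cos2pi.
split => //; first exact: circ0.
- rewrite circ1 s2 c2p scale1r subrr scale0r addr0 addr0 oAB c2 -qE1.
  have -> : omega q.1 0 = 0 :> R by rewrite /omega dot0l.
  have -> : - e * (`|relt p q| / (2 * pi)) * (0 - 2 * pi) = relt p q.
    rewrite -[RHS]eE; move: (@pi R) pi0 => P P0.
    by field; rewrite gt_eqF.
  by rewrite addr0 -qE2; case: (q).
- rewrite h2; congr (EFin (Num.sqrt _)); rewrite BB c2.
  by move: (@pi R) pi0 => P P0; field; rewrite gt_eqF.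
Qed.

End Distance.

(** * Metric properties *)

Section Metric.
Context {R : realType} {m : nat}.
Local Notation Z := ('rV[R]_m.+1 * 'rV[R]_m.+1)%type.
Local Notation H := (heis R m.+1).
Implicit Types (p q r : H) (x l t : R) (z : Z).

Definition dist p q : R := fine (cc_dist p q).

Lemma geodesic_dist p q l : joined p q l ->
    (forall k, 0 <= k -> (forall x, - pi < x < pi ->
       Phi x (relz p q) (relt p q) <= k ^+ 2) -> l <= k) ->
  cc_dist p q = l%:E.
Proof.
move=> [l0 [g [hg g0 g1 lg]]] lmin; apply/eqP; rewrite eq_le; apply/andP; split.
  by apply: ereal_inf_lbound; exists 0, 1, g.
apply: le_ereal_inf_tmp => _ [a [c [h [hh ha hc ->]]]].
have pi0 := @pi_gt0 R.
have [|k [k0 kE _]] := @Phi_le_length _ _ _ _ _ 0 hh; first by lra.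
rewrite kE lee_fin; apply: lmin => // x xpi.
have [k' [_]] := Phi_le_length hh xpi.
by rewrite kE ha hc => -[->].
Qed.

Lemma Phi_mu x z : - pi < x < pi ->
  Phi x z (mu x * dot z z) = (xcot x ^+ 2 + x ^+ 2) * dot z z.
Proof. by move=> xpi; rewrite (xcot_mu xpi) /Phi; ring. Qed.

Lemma cc_dist_nonvertical p q x : relz p q != 0 -> - pi < x < pi ->
    relt p q = mu x * dot (relz p q) (relz p q) ->
  cc_dist p q =
    (Num.sqrt ((xcot x ^+ 2 + x ^+ 2) * dot (relz p q) (relz p q)))%:E.
Proof.
move=> z0 xpi tE; apply: geodesic_dist; first exact: geodesic_nonvertical.
move=> k k0 /(_ x xpi); rewrite tE Phi_mu// => h.
by rewrite -(ger0_norm k0) -(sqrtr_sqr k) ler_wsqrtr.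
Qed.

(** The maximum over the closed interval is attained at an end point, which is
    approached from inside. *)
Lemma vertical_sup (t c : R) : (forall x, - pi < x < pi -> 2 * x * t <= c) ->
  2 * pi * `|t| <= c.
Proof.
move=> h; have pi0 := @pi_gt0 R.
set T := `|_|; have T0 : 0 <= T := normr_ge0 _.
apply/ler_addgt0Pr => e e0.
pose y := Num.max 0 (pi - e / (2 * T + 1)).
have eT : 0 < e / (2 * T + 1) by rewrite divr_gt0//; lra.
have y0 : 0 <= y by rewrite le_max lexx.
have ypi : y < pi by rewrite gt_max pi0; lra.
have yge : pi - e / (2 * T + 1) <= y by rewrite le_max lexx orbT.
have yT : 2 * y * T <= c.
  rewrite /T; have [t0|t0] := leP 0 t; first by rewrite ger0_norm//; apply: h; lra.
  by rewrite ltr0_norm// mulrN -mulNr -mulrN; apply: h; lra.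
have : e / (2 * T + 1) * (2 * T) <= e.
  by rewrite mulrAC ler_pdivrMr; [nra|lra].
by nra.
Qed.

Lemma cc_dist_vertical p q : relz p q = 0 ->
  cc_dist p q = (Num.sqrt (2 * pi * `|relt p q|))%:E.
Proof.
move=> z0; apply: geodesic_dist; first exact: geodesic_vertical.
move=> k k0 h.
rewrite -(ger0_norm k0) -(sqrtr_sqr k) ler_wsqrtr//.
apply: vertical_sup => x /h.
by rewrite /Phi z0 dot0l mulr0 addr0.
Qed.

Lemma exists_angle z t : z != 0 ->
  exists2 x, - pi < x < pi & t = mu x * dot z z.
Proof.
move=> z0; have [x xpi xE] := mu_surj (t / dot z z).
by exists x => //; rewrite xE divfK// dot_eq0.
Qed.

Lemma dist_geodesic p q : joined p q (dist p q) /\ cc_dist p q = (dist p q)%:E.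
Proof.
have [z0|z0] := eqVneq (relz p q) 0.
  rewrite /dist (cc_dist_vertical z0); split => //=; exact: geodesic_vertical.
have [x xpi xE] := exists_angle (relt p q) z0.
rewrite /dist (cc_dist_nonvertical z0 xpi xE); split => //=.
exact: geodesic_nonvertical.
Qed.

Lemma cc_distE p q : cc_dist p q = (dist p q)%:E.
Proof. by have [] := dist_geodesic p q. Qed.

Lemma dist_ge0 p q : 0 <= dist p q.
Proof. by have [[]] := dist_geodesic p q. Qed.

(** The squared distance as a function of the coordinates of p^-1 q. *)
Definition N2 z t : R := dist (0, 0) (z, t) ^+ 2.

Lemma rel0 z t : relz ((0, 0) : H) (z, t) = z /\ relt ((0, 0) : H) (z, t) = t.
Proof. by rewrite /relz /relt /= omega0l !subr0. Qed.

Lemma N2_nonvertical z x : z != 0 -> - pi < x < pi ->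
  N2 z (mu x * dot z z) = (xcot x ^+ 2 + x ^+ 2) * dot z z.
Proof.
move=> z0 xpi; have [h1 h2] := rel0 z (mu x * dot z z).
rewrite /N2 /dist (@cc_dist_nonvertical _ _ x) ?h1 ?h2//= sqr_sqrtr//.
by rewrite mulr_ge0 ?dot_ge0// addr_ge0 ?sqr_ge0.
Qed.

Lemma N2_vertical t : N2 0 t = 2 * pi * `|t|.
Proof.
have [h1 h2] := rel0 0 t.
rewrite /N2 /dist cc_dist_vertical ?h1 ?h2//= sqr_sqrtr//.
by rewrite !mulr_ge0 ?pi_ge0.
Qed.

Lemma dist_N2 p q : dist p q ^+ 2 = N2 (relz p q) (relt p q).
Proof.
have [z0|z0] := eqVneq (relz p q) 0.
  rewrite z0 N2_vertical /dist cc_dist_vertical//= sqr_sqrtr//.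
  by rewrite !mulr_ge0 ?pi_ge0.
have [x xpi xE] := exists_angle (relt p q) z0.
rewrite xE N2_nonvertical// /dist (cc_dist_nonvertical z0 xpi xE) sqr_sqrtr//.
by rewrite mulr_ge0 ?dot_ge0// addr_ge0 ?sqr_ge0.
Qed.

Lemma Phi_le_N2 x z t : - pi < x < pi -> Phi x z t <= N2 z t.
Proof.
move=> xpi; have [[_ [g [hg g0 g1 lg]]] _] := dist_geodesic (0, 0) (z, t).
have [l [_ lE]] := Phi_le_length hg xpi.
move: lE; rewrite lg g0 g1 => -[<-].
by have [-> ->] := rel0 z t.
Qed.

Lemma N2_le_sup z t c : (forall x, - pi < x < pi -> Phi x z t <= c) ->
  N2 z t <= c.
Proof.
move=> h; have [z0|z0] := eqVneq z 0; last first.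
  have [x xpi xE] := exists_angle t z0.
  by rewrite xE N2_nonvertical// -Phi_mu// -xE h.
rewrite z0 N2_vertical; apply: vertical_sup => x /h.
by rewrite /Phi z0 dot0l mulr0 addr0.
Qed.

Lemma xcot0 : xcot 0 = 1 :> R. Proof. by rewrite /xcot eqxx. Qed.
Lemma mu0 : mu 0 = 0 :> R. Proof. by rewrite /mu eqxx. Qed.

Lemma pi_bounds : - pi < (0 : R) < pi.
Proof. by have := @pi_gt0 R; lra. Qed.

Lemma N2_horizontal z : N2 z 0 = dot z z.
Proof.
have [->|z0] := eqVneq z 0; first by rewrite N2_vertical normr0 mulr0 dot0l.
have := N2_nonvertical z0 pi_bounds.
by rewrite mu0 mul0r xcot0 => ->; ring.
Qed.

Lemma dot_le_N2 z t : dot z z <= N2 z t.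
Proof.
have := Phi_le_N2 z t pi_bounds.
by rewrite /Phi xcot0 mul1r mulr0 mul0r add0r.
Qed.

(** The lower bound Phi x at the end of a segment, whose length is known. *)
Lemma xcot_le1 x z : - pi < x < pi -> xcot x * dot z z <= dot z z.
Proof.
by move=> /(Phi_le_N2 z 0); rewrite N2_horizontal /Phi mulr0 add0r.
Qed.

(** The choice x = pi / 2 or - pi / 2, for which xcot vanishes. *)
Lemma norm_le_N2 z t : pi * `|t| <= N2 z t.
Proof.
have pi0 := @pi_gt0 R.
have x0 : xcot (pi / 2) = 0 :> R.
  by rewrite /xcot gt_eqF ?cos_pihalf ?mulr0 ?mul0r// divr_gt0.
have xN0 : xcot (- (pi / 2)) = 0 :> R.
  by rewrite /xcot lt_eqF ?cosN ?cos_pihalf ?mulr0 ?mul0r// oppr_lt0 divr_gt0.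
have [t0|t0] := leP 0 t.
  have := @Phi_le_N2 (pi / 2) z t ltac:(lra).
  by rewrite /Phi x0 mul0r addr0 ger0_norm//; lra.
have := @Phi_le_N2 (- (pi / 2)) z t ltac:(lra).
by rewrite /Phi xN0 mul0r addr0 ltr0_norm//; lra.
Qed.

Lemma N2_le z t : N2 z t <= 2 * pi * `|t| + dot z z.
Proof.
apply: N2_le_sup => x xpi; rewrite /Phi lerD ?xcot_le1//.
have : x * t <= `|x * t| := ler_norm _.
rewrite normrM => h.
have : `|x| <= pi by rewrite ltW// ltr_norml.
by have := normr_ge0 t; nra.
Qed.

Lemma xcotN x : xcot (- x) = xcot x.
Proof.
rewrite /xcot oppr_eq0; case: ifP => // _.
by rewrite sinN cosN invrN mulrN !mulNr opprK.
Qed.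

Lemma N2N z t : N2 (- z) (- t) = N2 z t.
Proof.
have [->|z0] := eqVneq z 0; first by rewrite oppr0 !N2_vertical normrN.
have [x xpi ->] := exists_angle t z0.
have zz : dot (- z) (- z) = dot z z by rewrite !dotE opprK.
rewrite N2_nonvertical// -mulNr -muN -zz N2_nonvertical ?oppr_eq0//; last by lra.
by rewrite xcotN sqrrN zz.
Qed.

Lemma relzN p q : relz q p = - relz p q.
Proof. by rewrite /relz opprB. Qed.

Lemma reltN p q : relt q p = - relt p q.
Proof. by rewrite /relt [omega q.1 _]omegaC; ring. Qed.

Lemma distC p q : dist p q = dist q p.
Proof.
apply/eqP; rewrite -(@eqrXn2 _ 2) ?dist_ge0//.
by rewrite !dist_N2 relzN reltN N2N.
Qed.

Lemma dist_le p q c : 0 <= c -> N2 (relz p q) (relt p q) <= c ^+ 2 ->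
  dist p q <= c.
Proof. by move=> c0; rewrite -dist_N2 ler_sqr// nnegrE dist_ge0. Qed.

Lemma distxx p : dist p p = 0.
Proof.
apply/eqP; rewrite -sqrf_eq0 dist_N2 /relz /relt !subrr omega_id subrr.
by rewrite N2_horizontal dot0l.
Qed.

Lemma dist_eq0 p q : dist p q = 0 -> p = q.
Proof.
move=> d0; have := dist_N2 p q; rewrite d0 expr0n => /esym N0.
have pi0 := @pi_gt0 R.
have z0 : relz p q = 0.
  apply/eqP; rewrite -dot_eq0 eq_le dot_ge0 andbT.
  by apply: le_trans (dot_le_N2 _ (relt p q)) _; rewrite N0.
have t0 : relt p q = 0.
  apply/eqP; rewrite -normr_eq0 eq_le normr_ge0 andbT -(ler_pM2l pi0) mulr0.
  by apply: le_trans (norm_le_N2 (relz p q) _) _; rewrite N0.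
have e1 : q.1 = p.1 by apply/eqP; rewrite -subr_eq0; exact/eqP.
have e2 : q.2 = p.2 by move: t0; rewrite /relt e1 omega_id; lra.
by case: p q e1 e2 {d0 N0 z0 t0} => p1 p2 [q1 q2] /= -> ->.
Qed.

(** The calibration based at p and run along a minimizer from q to r, from time
    d(p, q) on: the bound of Phi at q by d(p, q)^2 propagates to r. The shift by
    e keeps the initial time positive when p = q. *)
Lemma dist_triangle p q r : dist p r <= dist p q + dist q r.
Proof.
apply/ler_addgt0Pr => e e0.
have d1 := dist_ge0 p q; have d2 := dist_ge0 q r.
apply: dist_le; first by lra.
apply: N2_le_sup => x xpi.
have [[_ [g [hg g0 g1 lg]]] _] := dist_geodesic q r.
have [l [_ lE cal]] := curve_calibration hg.
move: lE cal; rewrite lg => -[<-]; rewrite g0 g1 => cal {l lg hg}.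
set d := dist p q in d1 *; set d' := dist q r in d2 cal *.
have s0 : 0 < d + e by lra.
have sd : 0 < d + e + d' by lra.
have ss : (d + e) / (d + e + d') <= 1 by rewrite ler_pdivrMr//; lra.
have ss0 : 0 <= (d + e) / (d + e + d') by rewrite divr_ge0// ltW.
have := cal (x / (d + e + d')) (d + e) p s0.
rewrite normrM normfV (gtr0_norm sd) divfK ?gt_eqF// ltr_norml => /(_ xpi) h.
have h1 : psi (x / (d + e + d')) (d + e) p q <= d + e.
  rewrite -(ler_pM2l s0) /psi mulrDr [in X in _ + X]mulrA ricc_xcot ?gt_eqF//.
  have -> : (d + e) * (2 * (x / (d + e + d')) * relt p q) =
    2 * (x / (d + e + d') * (d + e)) * relt p q by ring.
  apply: le_trans (Phi_le_N2 _ _ _) _.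
    rewrite -ltr_norml -mulrA normrM [_^-1 * _]mulrC (ger0_norm ss0).
    have : `|x| < pi by rewrite ltr_norml.
    by have := normr_ge0 x; nra.
  by rewrite -dist_N2 -/d; nra.
have {h1} : psi (x / (d + e + d')) (d + e + d') p r <= d + e + d' by lra.
rewrite -(ler_pM2l sd) /psi mulrDr [X in _ + X <= _]mulrA ricc_xcot ?gt_eqF//.
rewrite divfK ?gt_eqF// => h1.
rewrite /Phi.
have -> : 2 * x * relt p r =
   (d + e + d') * (2 * (x / (d + e + d')) * relt p r).
  by field; rewrite gt_eqF.
apply: le_trans h1 _; rewrite -expr2.
have -> : d + e + d' = d + d' + e by ring.
exact: lexx.
Qed.

End Metric.

(** For z of norm 1, x maximizes y |-> 2 y mu x + xcot y by the two sides of
    the closed form of the distance; comparing the maximizers x and y shows that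
    mu is nondecreasing. If mu took the same value k at x < y, hence also at the
    midpoint w, the three points (x, xcot x), (y, xcot y), (w, xcot w) would lie
    on a line 2 k X + Y = c and, by xcot_mu, on the circle X^2 + Y^2 = c. *)
Lemma mu_incr (R : realType) (x y : R) : - pi < x -> x < y -> y < pi -> mu x < mu y.
Proof.
move=> x1 xy y1.
pose z : 'rV[R]_1 * 'rV[R]_1 := (delta_mx 0 0, 0).
have zz : dot z z = 1.
  rewrite /dot (bigD1 ord0)//= big1 => [|i i0]; rewrite !mxE ?eqxx.
    by rewrite mulr1 mulr0 !addr0.
  by rewrite (negbTE i0) andbF !mul0r addr0.
have z0 : z != 0 by rewrite -dot_eq0 zz oner_eq0.
have maxi (a b : R) : - pi < a < pi -> - pi < b < pi ->
    2 * b * mu a + xcot b <= 2 * a * mu a + xcot a.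
  move=> api bpi; have := Phi_le_N2 z (mu a * dot z z) bpi.
  by rewrite N2_nonvertical// -Phi_mu// /Phi zz !mulr1.
have mono (a b : R) : - pi < a -> a < b -> b < pi -> mu a <= mu b.
  move=> a1 ab b1; have := maxi a b; have := maxi b a => h1 h2.
  have {}h1 := h1 ltac:(lra) ltac:(lra); have {}h2 := h2 ltac:(lra) ltac:(lra).
  by nra.
rewrite lt_neqAle mono// andbT; apply/eqP => mxy.
pose w := (x + y) / 2.
have mw : mu w = mu x.
  by apply/eqP; rewrite eq_le [in X in _ && X]mono ?{1}mxy ?mono//; rewrite /w; lra.
have ex := @xcot_mu R x ltac:(lra).
have ey := @xcot_mu R y ltac:(lra).
have ew := @xcot_mu R w ltac:(rewrite /w; lra).
rewrite -mxy in ey; rewrite mw in ew.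
have maxe (a b : R) : - pi < a < pi -> - pi < b < pi -> mu a = mu b ->
    2 * a * mu a + xcot a = 2 * b * mu a + xcot b.
  move=> api bpi ab; apply/eqP; rewrite eq_le maxi// andbT.
  by rewrite {1 2}ab maxi.
have exy : 2 * x * mu x + xcot x = 2 * y * mu x + xcot y.
  by apply: maxe => //; lra.
have exw : 2 * x * mu x + xcot x = 2 * w * mu x + xcot w.
  by apply: maxe => //; rewrite /w; lra.
move: (mu x) exy exw ex ey ew => k.
move: (xcot x) (xcot y) (xcot w) => gx gy gw exy exw ex ey ew.
have gyE : gy = gx + 2 * x * k - 2 * y * k by lra.
have gwE : gw = gx + 2 * x * k - 2 * w * k by lra.
have h1 : (y - x) * ((1 + 4 * k ^+ 2) * (x + y) - 4 * k * (gx + 2 * x * k)) = 0.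
  by move: ey; rewrite gyE => ey; nra.
have h2 : (w - x) * ((1 + 4 * k ^+ 2) * (x + w) - 4 * k * (gx + 2 * x * k)) = 0.
  by move: ew; rewrite gwE => ew; nra.
have {}h1 : (1 + 4 * k ^+ 2) * (x + y) - 4 * k * (gx + 2 * x * k) = 0.
  by move/eqP: h1; rewrite mulf_eq0 => /orP[/eqP|/eqP//]; lra.
have {}h2 : (1 + 4 * k ^+ 2) * (x + w) - 4 * k * (gx + 2 * x * k) = 0.
  by move/eqP: h2; rewrite mulf_eq0 => /orP[/eqP|/eqP//]; rewrite /w; lra.
have : (1 + 4 * k ^+ 2) * (y - w) = 0 by lra.
move/eqP; rewrite mulf_eq0 => /orP[/eqP|/eqP]; last by rewrite /w; lra.
by have := sqr_ge0 k; lra.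
Qed.

(** * Topology of the distance *)

Section DistanceCalculus.
Context {R : realType} {m : nat}.
Local Notation Z := ('rV[R]_m.+1 * 'rV[R]_m.+1)%type.
Local Notation H := (heis R m.+1).
Implicit Types (p q r u : H) (x t : R) (z : Z).

Lemma cvg_relz_dot (T : Type) (F : set_system T) {FF : Filter F}
    (f : T -> H) p q : f @ F --> q ->
  (fun y => dot (relz p (f y)) (relz p (f y))) @ F --> (dot (relz p q) (relz p q) : R).
Proof.
move=> fq; have h : (fun y => f y - p) @ F --> q - p.
  by apply: cvgB => //; exact: cvg_cst.
exact: (@cvg_dot _ _ _ _ _ (fun y => f y - p) (fun y => f y - p) _ _ h h).
Qed.

Lemma cvg_relt (T : Type) (F : set_system T) {FF : Filter F}
    (f : T -> H) p q : f @ F --> q ->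
  (fun y => relt p (f y)) @ F --> (relt p q : R).
Proof.
move=> fq; apply: cvgB; first apply: cvgB.
- by apply: (cvg_comp _ _ fq); exact: continuous_tc.
- exact: cvg_cst.
- have h : cst ((Jrot p.1, 0) : H) @ F --> ((Jrot p.1, 0) : H) by exact: cvg_cst.
  exact: (@cvg_dot _ _ _ _ _ f _ _ _ fq h).
Qed.

Lemma near_dist p (e : R) : 0 < e -> \forall q \near p, dist p q < e.
Proof.
move=> e0; have idp : (id : H -> H) @ p --> p by exact: cvg_id.
have h1 := cvg_relz_dot (p := p) idp.
have h2 := cvg_relt (p := p) idp.
have : (fun q => 2 * pi * `|relt p q| + dot (relz p q) (relz p q)) @ p -->
   2 * pi * `|relt p p| + dot (relz p p) (relz p p).
  apply: cvgD; last exact: h1.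
  by apply: cvgM; [exact: cvg_cst|apply: cvg_norm; exact: h2].
rewrite /relt /relz !subrr omega_id subrr normr0 mulr0 dot0l add0r.
have e2 : 0 < e ^+ 2 by rewrite exprn_gt0.
move=> /cvgr_lt/(_ _ e2); apply: filterS => q hq.
rewrite -ltr_sqr ?nnegrE ?dist_ge0 ?(ltW e0)//.
by rewrite dist_N2; apply: le_lt_trans (N2_le _ _) _.
Qed.

Lemma dist_continuous p : continuous (dist p).
Proof.
move=> q; apply/cvgrPdist_lt => e e0; have := near_dist q e0.
apply: filterS => r; rewrite ltr_norml => hr.
have := dist_triangle p q r; have := dist_triangle p r q.
by rewrite [dist r q]distC; lra.
Qed.

Lemma N2_continuous : continuous (fun u : H => N2 u.1 u.2).
Proof.
move=> u; have h := @dist_continuous (0, 0) u.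
rewrite /continuous_at /N2 -!surjective_pairing.
rewrite (_ : (fun v : H => _) = (fun v : H => dist (0, 0) v ^+ 2)); last first.
  by apply/funext => v; rewrite -surjective_pairing.
exact: (@cvgM _ _ _ _ (dist (0, 0)) (dist (0, 0)) _ _ h h).
Qed.

Lemma sqr_coord_le z i : z.1 0 i ^+ 2 <= dot z z /\ z.2 0 i ^+ 2 <= dot z z.
Proof.
have h : z.1 0 i ^+ 2 + z.2 0 i ^+ 2 <= dot z z.
  rewrite /dot (bigD1 i)//= -!expr2 lerDl; apply: sumr_ge0 => j _.
  by rewrite -!expr2 addr_ge0// sqr_ge0.
by have := sqr_ge0 (z.1 0 i); have := sqr_ge0 (z.2 0 i); lra.
Qed.

Lemma ler_norm_of_sqr (a b : R) : a ^+ 2 <= b ^+ 2 -> 0 <= b -> `|a| <= b.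
Proof. by move=> ab b0; rewrite -(ger0_norm b0) -ler_sqr ?nnegrE// !real_normK ?num_real. Qed.

Lemma dot_le_sum z w : dot z w <= dot z z + dot w w.
Proof.
have := dot_ge0 (z - w); have := dot_ge0 z; have := dot_ge0 w.
by rewrite !dotE [dot w z]dotC; lra.
Qed.

Lemma normr_omega_le z w : `|omega z w| <= dot z z + dot w w.
Proof.
rewrite ler_norml; apply/andP; split.
  by have := dot_le_sum (- w) (Jrot z); rewrite !dotE dot_Jrot opprK /omega; lra.
by have := dot_le_sum w (Jrot z); rewrite dot_Jrot /omega; lra.
Qed.

(** The coordinates of a point of the ball are bounded, because d^2 dominates
    |z|^2 and |t| in the coordinates of p^-1 q. *)
Lemma compact_ball p (c : R) : compact [set q | dist p q <= c].
Proof.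
have [c0|c0] := ltP c 0.
  have -> : [set q | dist p q <= c] = set0; last exact: compact0.
  by apply/seteqP; split => q //=; have := dist_ge0 p q; lra.
pose M : R := c + \sum_i (`|p.1.1 0 i| + `|p.1.2 0 i|).
have pi0 := @pi_gt0 R.
pose K : R := c ^+ 2 / pi + `|p.2| + (dot p.1 p.1 + c ^+ 2).
pose B : set 'rV[R]_m.+1 := [set v | forall i, `[- M, M]%classic (v ord0 i)].
have cB : compact B by apply: (@rV_compact _ _ (fun=> `[- M, M]%classic)) => i; exact: segment_compact.
apply: (@subclosed_compact _ _ ((B `*` B) `*` `[- K, K]%classic)).
- rewrite (_ : [set q | _] = dist p @^-1` [set x | x <= c])//.
  by apply: closed_comp; [move=> q _; exact: dist_continuous|exact: closed_le].
- by apply: compact_setX; [exact: compact_setX|exact: segment_compact].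
- move=> q /= qc.
  have q2 : N2 (relz p q) (relt p q) <= c ^+ 2.
    by rewrite -dist_N2 ler_sqr ?nnegrE ?dist_ge0.
  have zc : dot (relz p q) (relz p q) <= c ^+ 2 := le_trans (dot_le_N2 _ _) q2.
  have Mi i : `|p.1.1 0 i| + `|p.1.2 0 i| + c <= M.
    rewrite addrC lerD2l (bigD1 i)//= lerDl; apply: sumr_ge0 => j _.
    exact: addr_ge0.
  have bnd (a b : R) i : `|b| <= `|p.1.1 0 i| + `|p.1.2 0 i| ->
      (a - b) ^+ 2 <= dot (relz p q) (relz p q) -> `[- M, M]%classic a.
    move=> bi ab; rewrite /= in_itv/= -ler_norml.
    have : `|a - b| <= c by apply: ler_norm_of_sqr => //; exact: le_trans ab zc.
    have := ler_normD (a - b) b; rewrite subrK => h1 h2.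
    by have := Mi i; lra.
  split; first split.
  + move=> i; apply: (@bnd _ (p.1.1 0 i) i); first by rewrite lerDl.
    by have [+ _] := sqr_coord_le (relz p q) i; rewrite /relz /= !mxE.
  + move=> i; apply: (@bnd _ (p.1.2 0 i) i); first by rewrite lerDr.
    by have [_ +] := sqr_coord_le (relz p q) i; rewrite /relz /= !mxE.
  + have tc : `|relt p q| <= c ^+ 2 / pi.
      rewrite ler_pdivlMr// mulrC; exact: le_trans (norm_le_N2 _ _) q2.
    have oE : omega p.1 q.1 = omega p.1 (relz p q).
      by rewrite /relz omegaDr omegaNr omega_id subr0.
    have qE : q.2 = p.2 + relt p q + omega p.1 (relz p q).
      by rewrite -oE /relt; ring.
    have o1 : `|omega p.1 (relz p q)| <= dot p.1 p.1 + c ^+ 2.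
      by apply: le_trans (normr_omega_le _ _) _; rewrite lerD2l.
    rewrite /= in_itv/= -ler_norml qE.
    apply: le_trans (ler_normD _ _) _; have := ler_normD p.2 (relt p q).
    by rewrite /K; lra.
Qed.

End DistanceCalculus.

(** * First-order behaviour of the squared distance *)

Section Angle.
Context {R : realType} {m : nat}.
Local Notation Z := ('rV[R]_m.+1 * 'rV[R]_m.+1)%type.
Local Notation H := (heis R m.+1).
Implicit Types (p q r u : H) (x t : R) (z : Z).

(** Half the angle through which the minimizing arc from 0 to u turns. *)
Definition angle u : R :=
  get [set x | - pi < x < pi /\ u.2 = mu x * dot u.1 u.1].

Lemma angleP u : u.1 != 0 ->
  - pi < angle u < pi /\ u.2 = mu (angle u) * dot u.1 u.1.
Proof.
move=> u0; have [x xpi xE] := exists_angle u.2 u0.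
exact: (@getPex _ [set x | - pi < x < pi /\ u.2 = mu x * dot u.1 u.1] (ex_intro _ x (conj xpi xE))).
Qed.

Lemma N2_angle u : u.1 != 0 -> N2 u.1 u.2 = Phi (angle u) u.1 u.2.
Proof.
move=> u0; have [xpi xE] := angleP u0.
by rewrite {1 2}xE N2_nonvertical// -Phi_mu.
Qed.

(** The function Phi x whose x is optimal at u is a quadratic polynomial that
    bounds N2 from below and coincides with it at u; this is its expansion
    at u. *)
Lemma N2_increment u (d : H) : u.1 != 0 ->
  N2 u.1 u.2 + 2 * angle u * d.2 + 2 * xcot (angle u) * dot u.1 d.1 +
    xcot (angle u) * dot d.1 d.1 <= N2 (u.1 + d.1) (u.2 + d.2).
Proof.
move=> u0; have [xpi _] := angleP u0.
rewrite N2_angle//; apply: le_trans (Phi_le_N2 _ _ xpi).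
by rewrite /Phi !dotE [dot d.1 u.1]dotC; lra.
Qed.

Lemma dot_self_continuous : continuous (fun u : H => dot u.1 u.1).
Proof.
move=> u; have h : (id : H -> H) @ u --> u by exact: cvg_id.
exact: (@cvg_dot _ _ _ _ _ id id _ _ h h).
Qed.

Lemma near_nonvertical u : u.1 != 0 -> \forall v \near u, v.1 != 0.
Proof.
rewrite -dot_gt0 => u0.
have /cvgr_gt/(_ _ u0) := @dot_self_continuous u.
by apply: filterS => v; rewrite dot_gt0.
Qed.

(** As mu is increasing, to lie between two angles is an open condition on the
    ratio t / |z|^2. *)
Lemma angle_continuous u : u.1 != 0 -> {for u, continuous angle}.
Proof.
move=> u0; apply/cvgrPdist_lt => e e0.
have [/andP[x1 x2] xE] := angleP u0; have uu := u0; rewrite -dot_gt0 in uu.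
pose a := Num.max (angle u - e) ((angle u - pi) / 2).
pose b := Num.min (angle u + e) ((angle u + pi) / 2).
have a1 : - pi < a by rewrite lt_max; apply/orP; right; lra.
have a2 : a < angle u by rewrite gt_max; apply/andP; split; lra.
have a3 : angle u - e <= a by rewrite le_max lexx.
have b1 : b < pi by rewrite gt_min; apply/orP; right; lra.
have b2 : angle u < b by rewrite lt_min; apply/andP; split; lra.
have b3 : b <= angle u + e by rewrite ge_min lexx.
have api : a < pi by lra.
have bpi : - pi < b by lra.
have cl k : (fun v : H => v.2 - k * dot v.1 v.1) @ u --> u.2 - k * dot u.1 u.1.
  apply: cvgB; first exact: continuous_tc.
  by apply: cvgM; [exact: cvg_cst|exact: dot_self_continuous].
have ha : 0 < u.2 - mu a * dot u.1 u.1.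
  by rewrite xE -mulrBl mulr_gt0// subr_gt0; apply: mu_incr.
have hb : u.2 - mu b * dot u.1 u.1 < 0.
  by rewrite xE -mulrBl pmulr_llt0// subr_lt0; apply: mu_incr.
have /cvgr_gt/(_ _ ha) na := cl (mu a).
have /cvgr_lt/(_ _ hb) nb := cl (mu b).
have key v : v.1 != 0 -> 0 < v.2 - mu a * dot v.1 v.1 ->
    v.2 - mu b * dot v.1 v.1 < 0 -> `|angle u - angle v| < e.
  move=> v0; have [/andP[y1 y2] yE] := angleP v0; rewrite -dot_gt0 in v0.
  rewrite yE -!mulrBl pmulr_lgt0// pmulr_llt0// subr_gt0 subr_lt0 => va vb.
  have av : a < angle v.
    rewrite ltNge le_eqVlt; apply/negP => /orP[/eqP ya|ya].
      by move: va; rewrite ya ltxx.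
    by have := lt_trans va (mu_incr y1 ya api); rewrite ltxx.
  have bv : angle v < b.
    rewrite ltNge le_eqVlt; apply/negP => /orP[/eqP ya|ya].
      by move: vb; rewrite ya ltxx.
    by have := lt_trans vb (mu_incr bpi ya y2); rewrite ltxx.
  by rewrite ltr_norml; lra.
by near=> v; apply: key; near: v => //; exact: near_nonvertical.
Unshelve. all: by end_near. Qed.

Lemma xcot_angle u : u.1 != 0 ->
  xcot (angle u) = (N2 u.1 u.2 - 2 * angle u * u.2) / dot u.1 u.1.
Proof.
by move=> u0; rewrite N2_angle// /Phi addrC addKr mulfK// dot_eq0.
Qed.

(** Instead of the continuity of xcot at 0, this uses that of the distance. *)
Lemma xcot_angle_continuous u : u.1 != 0 ->
  {for u, continuous (fun v => xcot (angle v))}.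
Proof.
move=> u0.
have h : (fun v : H => (N2 v.1 v.2 - 2 * angle v * v.2) / dot v.1 v.1) @ u -->
    (N2 u.1 u.2 - 2 * angle u * u.2) / dot u.1 u.1.
  apply: cvgM; last by apply: cvgV; [rewrite dot_eq0|exact: dot_self_continuous].
  apply: cvgB; first exact: N2_continuous.
  apply: cvgM; last exact: continuous_tc.
  by apply: cvgM; [exact: cvg_cst|exact: angle_continuous].
move: h; rewrite -xcot_angle// => h; apply: cvg_trans h; apply: near_eq_cvg.
by have := near_nonvertical u0; apply: filterS => v v0; rewrite xcot_angle.
Qed.

(** The horizontal gradient of N2 at u, divided by 2, that is, the horizontal
    gradient of d^2 / 2. *)
Definition grad u : Z := angle u *: Jrot u.1 + xcot (angle u) *: u.1.

(** The eikonal equation for the distance to a point. *)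
Lemma grad_eikonal u : u.1 != 0 -> dot (grad u) (grad u) = N2 u.1 u.2.
Proof.
move=> u0; have [xpi xE] := angleP u0.
rewrite [in RHS]xE N2_nonvertical// /grad !dotE dot_Jrot dot_Jrotl dot_Jrotid; ring.
Qed.

Lemma sin_le_id x : 0 <= x -> sin x <= x.
Proof.
move=> x0; pose f := (fun y : R => y - sin y).
have df (y : R) : is_derive y 1 f (1 - cos y).
  by apply: is_derive_eq.
have : f 0 <= f x.
  apply: (@ger0_derive1_le_cc _ f 0 x); rewrite ?in_itv/= ?lexx ?x0//.
  - by move=> y _; rewrite derive1E derive_val subr_ge0 cos_le1.
  - apply/continuous_subspaceT => y; apply/differentiable_continuous.
    exact/derivable1_diffP.
by rewrite /f sin0 subrr; lra.
Qed.

Lemma N2_even z t : N2 z (- t) = N2 z t.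
Proof.
have [->|z0] := eqVneq z 0; first by rewrite !N2_vertical normrN.
have [x xpi ->] := exists_angle t z0.
rewrite -mulNr -muN !N2_nonvertical//; last by lra.
by rewrite xcotN sqrrN.
Qed.

(** Leaving the vertical axis in any direction decreases the distance at a
    positive rate: the balls have conical dents at their poles. Indeed xcot is
    at most 0 for x >= pi / 2, so N2 <= 2 x t = 2 pi t - 2 (pi - x) t, and
    pi - x >= sin x is bounded below by means of t = mu x |z|^2. *)
Lemma N2_near_vertical z t : z != 0 -> pi / 4 * dot z z <= `|t| ->
  N2 z t <= 2 * pi * `|t| - Num.sqrt (pi * `|t| * dot z z).
Proof.
move=> z0; wlog t0 : t / 0 <= t.
  move=> h; have [t0|t0] := leP 0 t; first exact: h.
  by move=> tz; rewrite -N2_even -normrN; apply: h; rewrite ?normrN//; lra.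
rewrite (ger0_norm t0) => tz.
have pi0 := @pi_gt0 R.
have [x /andP[x1 x2] xE] := exists_angle t z0.
have zz := z0; rewrite -dot_gt0 in zz.
have mu2 : mu (pi / 2) = pi / 4 :> R.
  rewrite /mu gt_eqF ?divr_gt0// cos_pihalf sin_pihalf.
  by move: (@pi R) => P; field.
have xp : pi / 2 <= x.
  rewrite leNgt; apply/negP => xp; have pi2 : pi / 2 < pi :> R by lra.
  have := mu_incr x1 xp pi2.
  rewrite mu2 -(ltr_pM2r zz) -xE; lra.
have sx : 0 < sin x by apply: sin_gt0_pi; lra.
have cx : cos x <= 0.
  have := @sin_ge0_pi R (x - pi / 2) ltac:(lra).
  by rewrite sinB cos_pihalf sin_pihalf; lra.
have xc : xcot x <= 0.
  rewrite /xcot gt_eqF; last by lra.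
  by rewrite ler_pdivrMr// mul0r; nra.
have s2 : sin x ^+ 2 * t >= dot z z * pi / 4.
  have -> : sin x ^+ 2 * t = (x - sin x * cos x) / 2 * dot z z.
    rewrite xE /mu gt_eqF; last by lra.
    by field; rewrite gt_eqF.
  have sc : sin x * cos x <= 0 by rewrite pmulr_rle0.
  have : pi / 4 <= (x - sin x * cos x) / 2 by lra.
  by move=> /(ler_wpM2r (ltW zz)); lra.
have px : sin x <= pi - x.
  have := @sin_le_id (pi - x) ltac:(lra).
  by rewrite sinB sinpi cospi; lra.
have N2E : N2 z t <= 2 * x * t.
  by rewrite xE N2_nonvertical// ?x1// -Phi_mu ?x1// -xE /Phi; nra.
have : Num.sqrt (pi * t * dot z z) <= 2 * t * sin x.
  have k0 : 0 <= 2 * t * sin x by rewrite !mulr_ge0// ltW.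
  rewrite -(ger0_norm k0) -(sqrtr_sqr (2 * t * sin x)) ler_wsqrtr//.
  by nra.
by nra.
Qed.

End Angle.

Section Descent.
Context {R : realType} {m : nat}.
Local Notation Z := ('rV[R]_m.+1 * 'rV[R]_m.+1)%type.
Local Notation H := (heis R m.+1).
Implicit Types (p q u : H) (t : R) (z w : Z).

Context {T : Type} {F : set_system T} {FF : Filter F}.
Context (a : T -> R) (d : T -> H)
  (a_gt0 : \forall x \near F, 0 < a x) (a_cvg : a @ F --> (0 : R)).

Lemma cvg_move u (v : H) : d @ F --> v -> (fun x => u + a x *: d x) @ F --> u.
Proof.
move=> dv; rewrite -[X in _ --> X]addr0; apply: cvgD; first exact: cvg_cst.
by rewrite -(scale0r v); apply: cvgZ.
Qed.

(** The sign condition is that the differential of N2 at u is negative on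
    (w, k). The increment inequality is applied at the moving end u + a d, whose
    optimal angle tends to that of u. *)
Lemma descent_nonvertical u w k : u.1 != 0 -> d @ F --> ((w, k) : H) ->
    2 * angle u * k + 2 * xcot (angle u) * dot u.1 w < 0 ->
  \forall x \near F, N2 (u + a x *: d x).1 (u + a x *: d x).2 < N2 u.1 u.2.
Proof.
move=> u0 dw neg; set U := (fun x => u + a x *: d x).
have Uu : U @ F --> u by exact: cvg_move dw.
have Aa : (fun x => angle (U x)) @ F --> angle u.
  exact: (@cvg_comp _ _ _ U angle _ _ _ Uu (angle_continuous u0)).
have Ga : (fun x => xcot (angle (U x))) @ F --> xcot (angle u).
  exact: (@cvg_comp _ _ _ U (fun v => xcot (angle v)) _ _ _ Uu (xcot_angle_continuous u0)).
have d2 : (fun x => (d x).2) @ F --> k.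
  exact: (@cvg_comp _ _ _ d (fun v : H => v.2) _ _ _ dw (@continuous_tc _ _ (w, k))).
have dz : (fun x => dot (U x).1 (d x).1) @ F --> dot u.1 w.
  by exact: (cvg_dot Uu dw).
have dd : (fun x => dot (d x).1 (d x).1) @ F --> dot w w.
  by exact: (cvg_dot dw dw).
have br : (fun x => 2 * angle (U x) * (d x).2 +
    2 * xcot (angle (U x)) * dot (U x).1 (d x).1 -
    a x * (xcot (angle (U x)) * dot (d x).1 (d x).1)) @ F -->
    2 * angle u * k + 2 * xcot (angle u) * dot u.1 w -
      0 * (xcot (angle u) * dot w w).
  apply: cvgB; last by apply: cvgM; [exact: a_cvg|apply: cvgM; [exact: Ga|exact: dd]].
  apply: cvgD; apply: cvgM; [|exact: d2| |exact: dz];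
    apply: cvgM; [exact: cvg_cst|exact: Aa|exact: cvg_cst|exact: Ga].
rewrite mul0r subr0 in br.
have /cvgr_lt/(_ _ neg) nbr := br.
have nU : \forall x \near F, (U x).1 != 0.
  by have := Uu _ (near_nonvertical u0).
near=> x.
have ax : 0 < a x by near: x.
have Ux : (U x).1 != 0 by near: x.
have := N2_increment (- (a x *: d x)) Ux.
have -> : (U x).1 + (- (a x *: d x)).1 = u.1 by rewrite /U /= addrK.
have -> : (U x).2 + (- (a x *: d x)).2 = u.2 by rewrite /U /= addrK.
have : 2 * angle (U x) * (d x).2 +
    2 * xcot (angle (U x)) * dot (U x).1 (d x).1 -
    a x * (xcot (angle (U x)) * dot (d x).1 (d x).1) < 0 by near: x.
rewrite !(dotNl, dotNr, dotZl, dotZr) /= /GRing.scale/= -(pmulr_rlt0 _ ax).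
rewrite -/(U x).
by lra.
Unshelve. all: by end_near. Qed.

Lemma descent_vertical t w : t != 0 -> w != 0 -> d @ F --> ((w, 0) : H) ->
  \forall x \near F, N2 (a x *: d x).1 (t + (a x *: d x).2) < N2 (0 : Z) t.
Proof.
move=> t0 w0 dw; have pi0 := @pi_gt0 R.
have d2 : (fun x => (d x).2) @ F --> (0 : R).
  exact: (@cvg_comp _ _ _ d (fun v : H => v.2) _ _ _ dw (@continuous_tc _ _ (w, 0))).
have dd : (fun x => dot (d x).1 (d x).1) @ F --> dot w w.
  by exact: (cvg_dot dw dw).
have at2 : (fun x => `|t + a x * (d x).2|) @ F --> `|t + 0 * 0|.
  by apply: cvg_norm; apply: cvgD; [exact: cvg_cst|apply: cvgM; [exact: a_cvg|exact: d2]].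
rewrite mulr0 addr0 in at2.
have br : (fun x => 2 * pi * `|(d x).2| -
     Num.sqrt (pi * `|t + a x * (d x).2| * dot (d x).1 (d x).1)) @ F -->
    2 * pi * `|(0 : R)| - Num.sqrt (pi * `|t| * dot w w).
  apply: cvgB; first by apply: cvgM; [exact: cvg_cst|apply: cvg_norm; exact: d2].
  apply: (@cvg_comp _ _ _ _ Num.sqrt); last exact: sqrt_continuous.
  by apply: cvgM; [apply: cvgM; [exact: cvg_cst|exact: at2]|exact: dd].
have neg : 2 * pi * `|(0 : R)| - Num.sqrt (pi * `|t| * dot w w) < 0.
  rewrite normr0 mulr0 sub0r oppr_lt0 sqrtr_gt0 !mulr_gt0 ?normr_gt0//.
  by rewrite dot_gt0.
have /cvgr_lt/(_ _ neg) nbr := br.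
have sm : (fun x => `|t + a x * (d x).2| -
    pi / 4 * (a x * a x * dot (d x).1 (d x).1)) @ F -->
    `|t| - pi / 4 * (0 * 0 * dot w w).
  apply: cvgB; first exact: at2.
  apply: cvgM; first exact: cvg_cst.
  by apply: cvgM; [apply: cvgM; exact: a_cvg|exact: dd].
rewrite mulr0 mul0r mulr0 subr0 in sm.
have tp : 0 < `|t| by rewrite normr_gt0.
have /cvgr_gt/(_ _ tp) nsm := sm.
have wp : 0 < dot w w by rewrite dot_gt0.
have /cvgr_gt/(_ _ wp) ndd := dd.
near=> x.
have ax : 0 < a x by near: x.
have dx : 0 < dot (d x).1 (d x).1 by near: x.
have h1 : 2 * pi * `|(d x).2| -
  Num.sqrt (pi * `|t + a x * (d x).2| * dot (d x).1 (d x).1) < 0 by near: x.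
have h2 : 0 < `|t + a x * (d x).2| -
    pi / 4 * (a x * a x * dot (d x).1 (d x).1) by near: x.
rewrite dot_gt0 in dx.
have := @N2_near_vertical _ _ (a x *: (d x).1) (t + a x * (d x).2).
rewrite scaler_eq0 negb_or dx gt_eqF//= !dotE => /(_ isT) h3.
apply: le_lt_trans (h3 _) _; first by lra.
rewrite N2_vertical.
have -> : Num.sqrt (pi * `|t + a x * (d x).2| * (a x * (a x * dot (d x).1 (d x).1)))
   = a x * Num.sqrt (pi * `|t + a x * (d x).2| * dot (d x).1 (d x).1).
  rewrite (_ : pi * _ * (a x * _) =
      a x ^+ 2 * (pi * `|t + a x * (d x).2| * dot (d x).1 (d x).1)); last by ring.
  by rewrite sqrtrM ?sqr_ge0// sqrtr_sqr gtr0_norm.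
have := ler_normD t (a x * (d x).2); rewrite normrM (gtr0_norm ax) => h4.
by nra.
Unshelve. all: by end_near. Qed.

End Descent.

(** * Nearest points *)

Section NearestPoints.
Context {R : realType} {m : nat}.
Local Notation Z := ('rV[R]_m.+1 * 'rV[R]_m.+1)%type.
Local Notation H := (heis R m.+1).
Implicit Types (E S : set H) (p q v : H) (w : Z).

Lemma nearestP E p q :
  nearest E p q <-> E q /\ forall y, E y -> dist p q <= dist p y.
Proof.
by rewrite /nearest; split => -[Eq h]; split => // y /h; rewrite !cc_distE lee_fin.
Qed.

(** The contingent cone: v is a limit of (y - q) / a with y in S and a -> 0+. *)
Definition bouligand S q v : Prop :=
  ~ \forall x \near filter_prod (0 : R)^'+ (nbhs v), ~ S (q + x.1 *: x.2).

Lemma bouligandS S E q v : S `<=` E -> bouligand S q v -> bouligand E q v.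
Proof. by move=> SE h hE; apply: h; apply: filterS hE => x; apply: contra_not => /SE. Qed.

Lemma near_fst_gt0 v : \forall x \near filter_prod (0 : R)^'+ (nbhs v), 0 < x.1.
Proof.
have h : (fst : R * H -> R) @ filter_prod (0 : R)^'+ (nbhs v) --> (0 : R)^'+.
  exact: cvg_fst.
by apply: (h [set x | 0 < x]); exact: nbhs_right_gt.
Qed.

Lemma cvg_fst0 v : (fst : R * H -> R) @ filter_prod (0 : R)^'+ (nbhs v) --> (0 : R).
Proof.
apply: (@cvg_trans _ ((0 : R)^'+)); first exact: cvg_fst.
exact: cvg_within.
Qed.

Lemma near_ray q v (U : set H) : nbhs q U ->
  \forall x \near filter_prod (0 : R)^'+ (nbhs v), U (q + x.1 *: x.2).
Proof.
have h : (snd : R * H -> H) @ filter_prod (0 : R)^'+ (nbhs v) --> v by exact: cvg_snd.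
exact: (cvg_move (@cvg_fst0 v) h).
Qed.

Lemma bouligand_interior E q v : nbhs q E -> bouligand E q v.
Proof.
move=> Eq h; have := @filter_ex _ (filter_prod (0 : R)^'+ (nbhs v)) _ _
  (filterI h (near_ray v Eq)).
by case=> x [].
Qed.

Lemma bouligand_tangent S q v : tangent_space S q v -> bouligand S q v.
Proof.
move=> [c [[dc _] Sc c0 cv]] h.
have lim : (fun a : R => (a, a^-1 *: (c a - q))) @ (0 : R)^'+ -->
    filter_prod (0 : R)^'+ (nbhs v).
  apply: (@cvg_pair _ _ _ _ ((0 : R)^'+) (nbhs v)); first exact: cvg_id.
  have := dc 0 => /cvg_dnbhs_at_right; rewrite -/(derive c 0 1) -derive1E cv.
  by under eq_fun do rewrite /= addr0 [_ *: 1]mulr1 c0.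
have := lim _ h; rewrite /= => h1.
have h2 : \forall a \near (0 : R)^'+, S (c a) by exact: cvg_within Sc.
have : \forall a \near (0 : R)^'+, False.
  near=> a.
  have a0 : 0 < a by near: a; exact: nbhs_right_gt.
  have : S (c a) by near: a.
  have : ~ S (q + a *: (a^-1 *: (c a - q))) by near: a.
  by rewrite scalerA divff ?gt_eqF// scale1r addrC subrK.
by move=> /filter_ex[].
Unshelve. all: by end_near. Qed.

Lemma dot_grad (u : H) w : 2 * dot w (grad u) =
  2 * angle u * omega u.1 w + 2 * xcot (angle u) * dot u.1 w.
Proof. by rewrite /grad !dotE [dot u.1 w]dotC /omega; ring. Qed.

(** The first-order condition at a nearest point q of p. *)
Lemma nearest_bouligand E p q w :
    nearest E p q -> bouligand E q (w, omega q.1 w) ->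
  (relz p q != 0 -> 0 <= dot w (grad (relz p q, relt p q))) /\
  (relz p q = 0 -> relt p q != 0 -> w = 0).
Proof.
move=> /nearestP[Eq near_q] bE.
pose G := filter_prod (0 : R)^'+ (nbhs ((w, omega q.1 w) : H)).
pose d (x : R * H) : H := (x.2.1, x.2.2 - omega p.1 x.2.1).
have relE (x : R * H) : relz p (q + x.1 *: x.2) = relz p q + (x.1 *: d x).1 /\
    relt p (q + x.1 *: x.2) = relt p q + (x.1 *: d x).2.
  split; first by rewrite /relz /= addrAC.
  by rewrite /relt omegaDr omegaZr /= /GRing.scale/=; ring.
have snd_cvg : (snd : R * H -> H) @ G --> ((w, omega q.1 w) : H) by exact: cvg_snd.
have dG : d @ G --> ((w, omega (relz p q) w) : H).
  have -> : (w, omega (relz p q) w) =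
      (w, omega q.1 w - omega p.1 w) :> H.
    by rewrite /relz omegaDl omegaNl.
  apply: (@cvg_pair _ _ _ _ (nbhs w) (nbhs (omega q.1 w - omega p.1 w)) _ _ _
    (fun x : R * H => x.2.1) (fun x : R * H => x.2.2 - omega p.1 x.2.1)).
    exact: (@cvg_comp _ _ _ snd (fun v : H => v.1) _ _ _ snd_cvg cvg_fst).
  apply: cvgB.
    exact: (@cvg_comp _ _ _ snd (fun v : H => v.2) _ _ _ snd_cvg cvg_snd).
  have h : cst ((Jrot p.1, 0) : H) @ G --> ((Jrot p.1, 0) : H) by exact: cvg_cst.
  exact: (cvg_dot snd_cvg h).
have closer y : dist p y ^+ 2 < dist p q ^+ 2 -> ~ E y.
  rewrite ltr_sqr ?nnegrE ?dist_ge0// => lt /near_q.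
  by rewrite leNgt lt.
split=> [z0|z0 t0].
  rewrite leNgt; apply/negP => neg; apply: bE.
  have neg' : 2 * angle (relz p q, relt p q) * omega (relz p q) w +
     2 * xcot (angle (relz p q, relt p q)) * dot (relz p q) w < 0.
    by have := dot_grad (relz p q, relt p q) w; move: neg => /=; lra.
  have key : \forall x \near G, N2 ((relz p q, relt p q) + x.1 *: d x).1
      ((relz p q, relt p q) + x.1 *: d x).2 < N2 (relz p q) (relt p q).
    exact: (@descent_nonvertical _ _ _ _ _ fst d (near_fst_gt0 _) (@cvg_fst0 _)
      (relz p q, relt p q) w _ z0 dG neg').
  apply: filterS key => x /=; have [h1 h2] := relE x.
  by rewrite -[X in N2 X _ < _]h1 -[X in N2 _ X < _]h2 -!dist_N2; exact: closer.
apply/eqP/negPn/negP => w0; apply: bE.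
rewrite z0 omega0l in dG.
have key : \forall x \near G, N2 (x.1 *: d x).1
    (relt p q + (x.1 *: d x).2) < N2 (0 : Z) (relt p q).
  exact: (@descent_vertical _ _ _ _ _ fst d (near_fst_gt0 _) (@cvg_fst0 _)
    _ _ t0 w0 dG).
apply: filterS key => x /=; have [h1 h2] := relE x.
rewrite z0 add0r in h1.
by rewrite -[X in N2 X _ < _]h1 -[X in N2 _ X < _]h2 -[in ltRHS]z0 -!dist_N2; exact: closer.
Qed.

(** The direction opposite to the gradient violates the first-order condition,
    and in the vertical case every nonzero direction does. *)
Lemma nearest_all_bouligand E p q : nearest E p q ->
  (forall w, bouligand E q (w, omega q.1 w)) -> p = q.
Proof.
move=> npq bE; apply: contrapT => pq.
have N0 : 0 < N2 (relz p q) (relt p q).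
  rewrite -dist_N2 exprn_gt0// lt_def dist_ge0 andbT.
  by apply/eqP => /dist_eq0.
have [z0|z0] := eqVneq (relz p q) 0.
  pose w : Z := (delta_mx 0 0, 0).
  have [_] := nearest_bouligand npq (bE w).
  have t0 : relt p q != 0.
    apply/eqP => t0; move: N0; rewrite z0 t0 N2_horizontal dot0l ltxx//.
  move=> /(_ z0 t0) [/matrixP/(_ 0 0)]; rewrite !mxE eqxx => /eqP.
  by rewrite oner_eq0.
have [+ _] := nearest_bouligand npq (bE (- grad (relz p q, relt p q))).
by move=> /(_ z0); rewrite dotNl grad_eikonal//=; lra.
Qed.

Lemma nearest_boundary E p q : nearest E p q -> p <> q -> boundary E q.
Proof.
move=> npq pq; have [Eq _] := npq; split; first exact: subset_closure.
move=> Eqi; apply: pq; apply: nearest_all_bouligand npq _ => w.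
exact: bouligand_interior.
Qed.

(** At a singular point the tangent directions are all the horizontal ones. *)
Lemma nearest_singular E p q : nearest E p q ->
  closed E -> singular_set (boundary E) q -> p = q.
Proof.
move=> npq cE [_ sing]; apply: nearest_all_bouligand npq _ => w.
apply: (@bouligandS (boundary E)); first by move=> x [+ _]; have /closure_id <- := cE.
by apply: bouligand_tangent; rewrite sing; apply/horizontalP.
Qed.

(** The tangent space and the horizontal space both have dimension 2 n >= 2 in
    dimension 2 n + 1, so they share a direction v. The intermediate value
    theorem for the defining function f, on the short segments
    q + a (v + l e) with |l| <= eta and e transverse, gives the points of S. *)
Lemma bouligand_C1 S q : C1_hypersurface S -> S q ->
  exists2 w : Z, w != 0 & bouligand S q (w, omega q.1 w).
Proof.
move=> hS Sq; have [U [f [oU Uq [df _] df0 SU]]] := hS q Sq.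
have fq : f q = 0.
  by have : (S `&` U) q by []; rewrite SU => -[].
have dfq := df q Uq.
have DE v : 'D_v f q = 'd f q v by rewrite deriveE.
have [e De] : exists e, 0 < 'D_e f q.
  have [e] := df0 q Uq; rewrite neq_lt => /orP[De|De]; last by exists e.
  by exists (- e); rewrite DE linearN -DE oppr_gt0.
have [w w0 Dw] : exists2 w : Z, w != 0 & 'D_(w, omega q.1 w) f q = 0.
  pose X : Z := (delta_mx 0 0, 0); pose Y : Z := (0, delta_mx 0 0).
  pose al := 'D_(X, omega q.1 X) f q; pose be := 'D_(Y, omega q.1 Y) f q.
  have [al0|al0] := eqVneq al 0.
    exists X => //; apply/eqP => -[/matrixP/(_ 0 0)]; rewrite !mxE eqxx => /eqP.
    by rewrite oner_eq0.
  exists (be *: X - al *: Y).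
    apply/eqP => -[_ /matrixP/(_ 0 0)]; rewrite !mxE eqxx mulr0 mulr1 sub0r.
    by move/eqP; rewrite oppr_eq0; exact/negP.
  have -> : (be *: X - al *: Y, omega q.1 (be *: X - al *: Y)) =
      be *: ((X, omega q.1 X) : H) - al *: ((Y, omega q.1 Y) : H).
    by congr pair; rewrite omegaDr omegaNr !omegaZr.
  have lin (x y : H) : 'd f q (be *: x - al *: y) = be * 'd f q x - al * 'd f q y.
    by rewrite linearB !linearZ.
  by rewrite DE lin -[in X in X - _]DE -[in X in _ - X]DE -/al -/be mulrC subrr.
exists w => //; set v : H := (w, omega q.1 w) in Dw *; move=> h.
have [[A Q] [/= A0 Qv] AQ] := filterI h (near_ray v (open_nbhs_nbhs (conj oU Uq))).
have [eta eta0 etaQ] : exists2 eta : R, 0 < eta &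
    forall l, `|l| <= eta -> Q (v + l *: e).
  have cl : (fun l : R => v + l *: e) @ (0 : R) --> v.
    rewrite -[X in _ --> X]addr0 -(scale0r e); apply: cvgD; first exact: cvg_cst.
    exact: scalel_continuous.
  have /nbhs_ballP[eps /= eps0 he] := cl _ Qv.
  exists (eps / 2); first by rewrite divr_gt0.
  move=> l hl; apply: (he l); rewrite /ball/= sub0r normrN.
  by apply: le_lt_trans hl _; lra.
have sgn (s : R) : (fun a : R => s * (a^-1 * f (q + a *: (v + (s * eta) *: e)))) @ 0^'+ -->
    s * (s * eta * 'D_e f q).
  apply: cvgM; first exact: cvg_cst.
  have := (@diff_derivable _ _ _ f q (v + (s * eta) *: e) dfq).
  rewrite /derivable => /cvg_dnbhs_at_right; rewrite -/(derive f q _).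
  rewrite DE linearD linearZ -!DE Dw add0r.
  by under eq_fun do rewrite /= fq subr0 addrC.
have P1 : 0 < 1 * (1 * eta * 'D_e f q) by rewrite !mul1r mulr_gt0.
have P2 : 0 < -1 * (-1 * eta * 'D_e f q) by rewrite !mulN1r mulNr opprK mulr_gt0.
have /cvgr_gt/(_ _ P1) n1 := sgn 1.
have /cvgr_gt/(_ _ P2) n2 := sgn (-1).
suff /filter_ex[] : \forall a \near (0 : R)^'+, False by [].
near=> a.
have a0 : 0 < a by near: a; exact: nbhs_right_gt.
have Aa : A a by near: a.
have f1 : 0 < 1 * (a^-1 * f (q + a *: (v + (1 * eta) *: e))) by near: a.
have f2 : 0 < -1 * (a^-1 * f (q + a *: (v + (-1 * eta) *: e))) by near: a.
rewrite !mul1r pmulr_rgt0 ?invr_gt0// in f1.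
rewrite !mulN1r oppr_gt0 pmulr_rlt0 ?invr_gt0// in f2.
have UaS l : `|l| <= eta -> ~ S (q + a *: (v + l *: e)) /\ U (q + a *: (v + l *: e)).
  by move=> hl; have := AQ (a, v + l *: e) (conj Aa (etaQ l hl)).
have [|||l leta fl] := @IVT _ (fun l => f (q + a *: (v + l *: e))) (- eta) eta 0.
- by lra.
- apply: continuous_in_subspaceT => l; rewrite inE/= in_itv/= -ler_norml => hl.
  have c1 : (fun k : R => q + a *: (v + k *: e)) @ l --> q + a *: (v + l *: e).
    apply: cvgD; first exact: cvg_cst.
    apply: cvgZr; apply: cvgD; first exact: cvg_cst.
    exact: scalel_continuous.
  have c2 : f @ (q + a *: (v + l *: e)) --> f (q + a *: (v + l *: e)).
    by apply: differentiable_continuous; apply: df; have [] := UaS l hl.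
  exact: (@cvg_comp _ _ _ (fun k : R => q + a *: (v + k *: e)) f _ _ _ c1 c2).
- by rewrite ge_min le_max (ltW f1) (ltW f2) orbT.
rewrite in_itv/= -ler_norml in leta.
have [nS Ul] := UaS l leta; apply: nS.
have : [set p | U p /\ f p = 0] (q + a *: (v + l *: e)) by [].
by rewrite -SU => -[].
Unshelve. all: by end_near. Qed.

(** A C1 hypersurface cannot be tangent to a ball from outside at one of its
    poles, because of the conical dents. *)
Lemma nearest_nonvertical E p q : closed E -> C1_hypersurface (boundary E) ->
  nearest E p q -> p <> q -> relz p q != 0.
Proof.
move=> cE hS npq pq; have bq := nearest_boundary npq pq.
have [w w0 bw] := bouligand_C1 hS bq.
have bE : bouligand E q (w, omega q.1 w).
  apply: bouligandS bw => x [+ _]; have /closure_id <- := cE; exact.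
have [_ h] := nearest_bouligand npq bE.
apply/eqP => z0; move/eqP: w0; apply; apply: h => //.
apply/eqP => t0; apply: pq; apply: dist_eq0; apply/eqP.
by rewrite -sqrf_eq0 dist_N2 z0 t0 N2_horizontal dot0l.
Qed.

End NearestPoints.

(** * Sliding away from the set *)

Section Reach.
Context {R : realType} {m : nat}.
Local Notation Z := ('rV[R]_m.+1 * 'rV[R]_m.+1)%type.
Local Notation H := (heis R m.+1).
Implicit Types (E S : set H) (p q v : H) (w : Z).

Definition proj E p : H := get (nearest E p).

Lemma projP E p : Unp E p -> nearest E p (proj E p).
Proof. by move=> [x [px _]]; apply: getPex; exists x. Qed.

Lemma proj_uniq E p x : Unp E p -> nearest E p x -> x = proj E p.
Proof.
move=> Up px; have pp := projP Up; case: Up => y [_ yu].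
by rewrite -(yu _ px) -(yu _ pp).
Qed.

Definition depth E p : R := dist p (proj E p).

Lemma depth_le E p y : Unp E p -> E y -> depth E p <= dist p y.
Proof. by move=> /projP/nearestP[_]; apply. Qed.

Lemma depth_lip E p q : Unp E p -> Unp E q -> depth E p <= depth E q + dist p q.
Proof.
move=> Up Uq; have /nearestP[Eq _] := projP Uq.
apply: le_trans (depth_le Up Eq) _; rewrite addrC; exact: dist_triangle.
Qed.

Lemma depth_gt0 E p : Unp E p -> ~ E p -> 0 < depth E p.
Proof.
move=> Up Ep; rewrite lt_def dist_ge0 andbT; apply/eqP => /dist_eq0 pE.
by apply: Ep; rewrite pE; have /nearestP[] := projP Up.
Qed.

Lemma depth0 E p : Unp E p -> E p -> depth E p = 0.
Proof.
move=> Up Ep; apply/eqP; rewrite eq_le dist_ge0 andbT.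
by apply: le_trans (depth_le Up Ep) _; rewrite distxx.
Qed.

(** Balls are compact and the nearest point is unique, so it varies
    continuously. *)
Lemma proj_continuous E p : closed E -> nbhs p (Unp E) ->
  {for p, continuous (proj E)}.
Proof.
move=> cE Up V Vp.
have Upp := nbhs_singleton Up.
have [W [[oW Wp] WV]] : exists W, open_nbhs (proj E p) W /\ W `<=` V.
  by have := Vp; rewrite nbhsE => -[W ? ?]; exists W.
pose K := [set y | dist p y <= depth E p + 1] `&` (E `\` W).
have cK : compact K.
  apply: compact_closedI; first exact: compact_ball.
  by apply: closedI => //; exact: open_closedC.
have [r r0 hr] : exists2 r : R, 0 < r & forall y, K y -> depth E p + r <= dist p y.
  have [K0|/set0P K0] := eqVneq K set0; first by exists 1 => // y; rewrite K0.
  have [|y0 y0K y0min] := compact_EVT_min K0 cK (f := dist p).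
    by apply: continuous_subspaceT; exact: dist_continuous.
  rewrite inE in y0K; have [_ [Ey0 Wy0]] := y0K.
  exists (dist p y0 - depth E p); last by move=> y Ky; rewrite addrC subrK y0min// inE.
  rewrite subr_gt0 lt_neqAle depth_le// andbT; apply/eqP => dE.
  apply: Wy0; rewrite (_ : y0 = proj E p)//; apply: proj_uniq => //.
  apply/nearestP; split => // y Ey; rewrite -dE; exact: depth_le.
pose s := Num.min r 1 / 2.
have s0 : 0 < s by rewrite divr_gt0// lt_min r0 ltr01.
have sr : 2 * s <= r by rewrite /s mulrC divfK// ge_min lexx.
have s1 : 2 * s <= 1 by rewrite /s mulrC divfK// ge_min lexx orbT.
suff : \forall p' \near p, V (proj E p') by [].
near=> p'.
have pp' : dist p p' < s by near: p'; exact: near_dist.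
have Up' : Unp E p' by near: p'.
apply: WV; apply: contrapT => nW.
have /nearestP[Ep' _] := projP Up'.
have d1 : dist p (proj E p') <= dist p p' + depth E p' := dist_triangle _ _ _.
have := depth_lip Up' Upp; rewrite [dist p' p]distC => d2.
have Kp : K (proj E p') by split => //=; lra.
by have := hr _ Kp; lra.
Unshelve. all: by end_near. Qed.

(** The point reached from p at time a along the horizontal line of direction w. *)
Definition ray p w (a : R) : H := p + a *: ((w, omega p.1 w) : H).

Lemma ray_rel p q w a : relz q (ray p w a) = relz q p + a *: w /\
  relt q (ray p w a) = relt q p + a * omega (relz q p) w.
Proof.
rewrite /ray /relz /relt /= addrAC; split=> //.
by rewrite omegaDr omegaZr omegaDl omegaNl /GRing.scale/=; ring.
Qed.

Lemma dist_ray p w a : 0 <= a -> dot w w = 1 -> dist p (ray p w a) <= a.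
Proof.
move=> a0 w1; apply: dist_le => //; have [-> ->] := ray_rel p p w a.
rewrite /relz /relt !subrr omega_id omega0l mulr0 addr0 subrr add0r.
by rewrite N2_horizontal !dotE w1 mulr1 expr2.
Qed.

Lemma ray_cvg p w : ray p w a @[a --> (0 : R)^'+] --> p.
Proof.
have h : ray p w @ (0 : R) --> p.
  rewrite -[X in _ --> X]addr0 -(scale0r ((w, omega p.1 w) : H)).
  by apply: cvgD; [exact: cvg_cst|exact: scalel_continuous].
exact: (cvg_at_right_filter h).
Qed.

(** The depth increases at unit rate in the direction opposite to the nearest
    point q of p. The nearest point q' of the new point p' may differ from q, but
    depth(p')^2 - depth(p)^2 >= d(q', p')^2 - d(q', p)^2, and this increment is
    governed by the gradient at the pair (q', p), which tends to the one at
    (q, p) because the projection is continuous. *)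
Lemma depth_slope E p e : closed E -> C1_hypersurface (boundary E) ->
    nbhs p (Unp E) -> ~ E p -> 0 < e < 1 ->
  exists w, dot w w = 1 /\ \forall a \near (0 : R)^'+,
    depth E p + (1 - e) * a <= depth E (ray p w a).
Proof.
move=> cE hS Up Ep /andP[e0 e1]; have Upp := nbhs_singleton Up.
have np := projP Upp; set q := proj E p in np.
have pq : p <> q by move=> pq; apply: Ep; rewrite pq; have /nearestP[] := np.
have dp0 : 0 < depth E p by exact: depth_gt0.
set D := depth E p in dp0 *.
pose rel y : H := (relz y p, relt y p).
have relN2 y : N2 (rel y).1 (rel y).2 = dist y p ^+ 2 by rewrite dist_N2.
have z0 : (rel q).1 != 0.
  by rewrite /rel relzN oppr_eq0; exact: nearest_nonvertical cE hS np pq.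
have N2q : N2 (rel q).1 (rel q).2 = D ^+ 2 by rewrite relN2 distC.
pose w := D^-1 *: grad (rel q).
have w1 : dot w w = 1.
  by rewrite /w dotZl dotZr grad_eikonal// N2q; field; rewrite gt_eqF.
exists w; split => //.
have wg : 2 * dot w (grad (rel q)) = 2 * D.
  by rewrite /w dotZl grad_eikonal// N2q; field; rewrite gt_eqF.
clearbody w.
have Py : (fun a => proj E (ray p w a)) @ (0 : R)^'+ --> q.
  exact: (@cvg_comp _ _ _ (ray p w) (proj E) _ _ _ (@ray_cvg p w)
    (proj_continuous cE Up)).
have relc : {for q, continuous rel}.
  have qq : (id : H -> H) @ q --> q by exact: cvg_id.
  have J : cst ((Jrot p.1, 0) : H) @ q --> ((Jrot p.1, 0) : H) by exact: cvg_cst.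
  have -> : rel = (fun y => - ((y.1 - p.1, y.2 - p.2 - dot y.1 (Jrot p.1)) : H)).
    by apply/funext => y; rewrite /rel relzN reltN.
  apply: cvgN; apply: (@cvg_pair _ _ _ _ (nbhs (q.1 - p.1))
      (nbhs (q.2 - p.2 - dot q.1 (Jrot p.1))) _ _ _ (fun y : H => y.1 - p.1)
      (fun y : H => y.2 - p.2 - dot y.1 (Jrot p.1))).
    by apply: cvgB; [exact: cvg_fst|exact: cvg_cst].
  apply: cvgB; first by apply: cvgB; [exact: cvg_snd|exact: cvg_cst].
  exact: (cvg_dot qq J).
have Uc : (fun a => rel (proj E (ray p w a))) @ (0 : R)^'+ --> rel q.
  exact: (@cvg_comp _ _ _ (fun a => proj E (ray p w a)) rel _ _ _ Py relc).
set U := (fun a => rel (proj E (ray p w a))) in Uc.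
have Ac : (fun a => angle (U a)) @ (0 : R)^'+ --> angle (rel q).
  exact: (@cvg_comp _ _ _ U angle _ _ _ Uc (angle_continuous z0)).
have Gc : (fun a => xcot (angle (U a))) @ (0 : R)^'+ --> xcot (angle (rel q)).
  exact: (@cvg_comp _ _ _ U (fun v => xcot (angle v)) _ _ _ Uc (xcot_angle_continuous z0)).
have wc : cst ((w, 0) : H) @ (0 : R)^'+ --> ((w, 0) : H) by exact: cvg_cst.
have Jc : cst ((Jrot w, 0) : H) @ (0 : R)^'+ --> ((Jrot w, 0) : H) by exact: cvg_cst.
have idc : (id : R -> R) @ (0 : R)^'+ --> (0 : R) by exact: cvg_within.
have Bc : (fun a => 2 * angle (U a) * - dot (U a).1 (Jrot w) +
    2 * xcot (angle (U a)) * dot (U a).1 w + a * xcot (angle (U a))) @ (0 : R)^'+ -->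
    2 * angle (rel q) * - dot (rel q).1 (Jrot w) +
    2 * xcot (angle (rel q)) * dot (rel q).1 w + 0 * xcot (angle (rel q)).
  apply: cvgD; last by apply: cvgM; [exact: idc|exact: Gc].
  apply: cvgD; apply: cvgM.
  - by apply: cvgM; [exact: cvg_cst|exact: Ac].
  - by apply: cvgN; exact: (cvg_dot Uc Jc).
  - by apply: cvgM; [exact: cvg_cst|exact: Gc].
  - exact: (cvg_dot Uc wc).
have gradE (u : H) : 2 * angle u * - dot u.1 (Jrot w) +
    2 * xcot (angle u) * dot u.1 w = 2 * dot w (grad u).
  by rewrite dot_grad omegaC.
rewrite gradE wg mul0r addr0 in Bc.
have lt2D : 2 * D * (1 - e / 2) < 2 * D by nra.
have /cvgr_gt/(_ _ lt2D) nB := Bc.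
have nU : \forall a \near (0 : R)^'+, (U a).1 != 0.
  exact: (Uc _ (near_nonvertical z0)).
have nP : \forall a \near (0 : R)^'+, Unp E (ray p w a).
  exact: (@ray_cvg p w _ Up).
have De0 : 0 < D * e by rewrite mulr_gt0.
near=> a.
have a0 : 0 < a by near: a; exact: nbhs_right_gt.
have aDe : a < D * e by near: a; exact: nbhs_right_lt.
have U0 : (U a).1 != 0 by near: a.
have UP : Unp E (ray p w a) by near: a.
have B : 2 * D * (1 - e / 2) < 2 * angle (U a) * - dot (U a).1 (Jrot w) +
    2 * xcot (angle (U a)) * dot (U a).1 w + a * xcot (angle (U a)) by near: a.
set p' := ray p w a in UP *; set q' := proj E p'.
have inc := N2_increment (a *: ((w, omega (U a).1 w) : H)) U0.
have [r1 r2] := ray_rel p q' w a.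
have dE : N2 ((U a).1 + (a *: ((w, omega (U a).1 w) : H)).1)
     ((U a).2 + (a *: ((w, omega (U a).1 w) : H)).2) = depth E p' ^+ 2.
  by rewrite /depth distC dist_N2 r1 r2.
have Eq' : E q' by have /nearestP[] := projP UP.
have D1 : D ^+ 2 <= N2 (U a).1 (U a).2.
  by rewrite relN2 ler_sqr ?nnegrE ?dist_ge0 ?(ltW dp0)// distC depth_le.
rewrite dE /= !dotZr !dotZl w1 /GRing.scale/= omegaC in inc.
have key : D ^+ 2 + a * (2 * D * (1 - e / 2)) <= depth E p' ^+ 2.
  have := ler_wpM2l (ltW a0) (ltW B).
  move: inc D1; rewrite /omega.
  move: (N2 _ _) (angle _) (xcot _) (dot (U a).1 _) (dot (U a).1 _) (depth E p').
  by clear; move=> *; lra.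
have De : 0 <= D + (1 - e) * a by rewrite addr_ge0 ?mulr_ge0 ?ltW// subr_gt0.
rewrite -ler_sqr ?nnegrE ?dist_ge0//; apply: le_trans key.
have e1' : (1 - e) ^+ 2 <= 1 by move: (e) e0 e1; clear; move=> *; nra.
have : (1 - e) ^+ 2 * a <= D * e by apply: le_trans (ltW aDe); rewrite ler_piMl// ltW.
move=> /(ler_wpM2l (ltW a0)); move: (D) (e) (a); clear; move=> *; lra.
Unshelve. all: by end_near. Qed.

(** For p1 outside E and close to q0, let p maximize depth - (1 - e) d(p1, .) on
    the ball. By the slope lemma p is not interior to the ball, and comparison
    with the value at p1 gives depth(p) >= (1 - e) d(p1, p). *)
Lemma deep_point E q0 (r k : R) : closed E -> C1_hypersurface (boundary E) ->
    boundary E q0 -> 0 < r -> 0 < k ->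
    (forall p, dist q0 p <= r -> nbhs p (Unp E)) ->
  exists2 p, dist q0 p = r & r - k <= depth E p.
Proof.
move=> cE hS [_ q0i] r0 k0 hU.
have hU' p : dist q0 p <= r -> Unp E p by move=> /hU/nbhs_singleton.
(* Losses of k / 2 each from the slope 1 - e, as d(p1, p) <= 2 r, and from
   d(q0, p1) < k / 2. *)
pose e := Num.min (1 / 2) (k / (4 * r)).
have e0 : 0 < e by rewrite lt_min !divr_gt0// mulr_gt0.
have e12 : e <= 1 / 2 by rewrite ge_min lexx.
have er : e * (4 * r) <= k by rewrite -ler_pdivlMr ?mulr_gt0// ge_min lexx orbT.
pose k' := Num.min r (k / 2).
have k'0 : 0 < k' by rewrite lt_min r0 divr_gt0.
have k'r : k' <= r by rewrite ge_min lexx.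
have k'k : k' <= k / 2 by rewrite ge_min lexx orbT.
have [p1 d1 nE1] : exists2 p1, dist q0 p1 < k' & ~ E p1.
  apply: contrapT => h; apply: q0i; rewrite /interior.
  apply: filterS (near_dist q0 k'0) => p dp; apply: contrapT => nEp.
  by apply: h; exists p.
have U1 : Unp E p1 by apply: hU'; lra.
pose K := [set p | dist q0 p <= r].
have cK : compact K := @compact_ball _ _ q0 r.
have K0 : K !=set0 by exists q0; rewrite /K /= distxx ltW.
have depth_c : {in K, continuous (depth E)}.
  move=> p; rewrite inE => pK; apply/cvgrPdist_lt => s s0.
  have Up := hU' _ pK; near=> y.
  have Uy : Unp E y by near: y; exact: hU.
  have dy : dist p y < s by near: y; exact: near_dist.
  have := depth_lip Up Uy; have := depth_lip Uy Up.
  by rewrite [dist y p]distC ltr_norml; lra.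
pose G p := depth E p - (1 - e) * dist p1 p.
have cG : {within K, continuous G}.
  apply: continuous_in_subspaceT => p pK; apply: cvgB; first exact: depth_c.
  by apply: cvgM; [exact: cvg_cst|exact: dist_continuous].
have [p pK pmax] := compact_EVT_max K0 cK cG; rewrite inE in pK.
have Up := hU' _ pK.
have G1 : 0 < G p.
  have : G p1 <= G p by apply: pmax; rewrite inE /K /= ltW//; lra.
  by rewrite {1}/G distxx mulr0 subr0; exact: lt_le_trans (depth_gt0 U1 nE1).
have dp1 := dist_ge0 p1 p.
have nEp : ~ E p.
  by move=> Ep; move: G1; rewrite /G (depth0 Up Ep); nra.
have dpr : dist q0 p = r.
  apply/eqP; rewrite eq_le pK /= leNgt; apply/negP => dr.
  have e1 : 0 < e / 2 < 1 by lra.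
  have [w [w1 hw]] := depth_slope cE hS (hU _ pK) nEp e1.
  have near_r : \forall a \near (0 : R)^'+, dist q0 (ray p w a) < r.
    have c : (fun a => dist q0 (ray p w a)) @ (0 : R)^'+ --> dist q0 p.
      exact: (@cvg_comp _ _ _ (ray p w) (dist q0) _ _ _ (@ray_cvg p w)
        (@dist_continuous _ _ q0 p)).
    by move/cvgr_lt/(_ _ dr) : c.
  suff /filter_ex[] : \forall a \near (0 : R)^'+, False by [].
  near=> a.
  have a0 : 0 < a by near: a; exact: nbhs_right_gt.
  have h1 : depth E p + (1 - e / 2) * a <= depth E (ray p w a) by near: a.
  have h2 : dist q0 (ray p w a) < r by near: a.
  have : G (ray p w a) <= G p by apply: pmax; rewrite inE /K /= ltW.
  have da := dist_ray p (ltW a0) w1.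
  have c1 : (1 - e) * dist p1 (ray p w a) <= (1 - e) * (dist p1 p + a).
    apply: ler_wpM2l; first by lra.
    by apply: le_trans (dist_triangle p1 p _) _; rewrite lerD2l.
  rewrite /G => c2; have : e * a <= 0 by lra.
  by rewrite leNgt mulr_gt0.
exists p => //.
have x1 := dist_triangle q0 p1 p; have x2 := dist_triangle p1 q0 p.
rewrite [dist p1 q0]distC dpr in x2; rewrite dpr in x1.
have ex : e * dist p1 p <= e * (2 * r) by apply: ler_wpM2l; [exact: ltW|lra].
by move: G1; rewrite /G; lra.
Unshelve. all: by end_near. Qed.

(** Otherwise the deepest point of a sphere around q0 would have q0 as a nearest
    point. *)
Lemma singular_notin_Unp E q0 (r : R) : closed E -> C1_hypersurface (boundary E) ->
    singular_set (boundary E) q0 -> 0 < r ->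
  exists2 p, dist q0 p < r & ~ Unp E p.
Proof.
move=> cE hS sing r0; apply: contrapT => h.
have hU p : dist q0 p < r -> Unp E p.
  by move=> dp; apply: contrapT => nU; apply: h; exists p.
have hU' p : dist q0 p <= r / 2 -> nbhs p (Unp E).
  move=> dp; have dr : dist q0 p < r by lra.
  have /cvgr_lt/(_ _ dr) := @dist_continuous _ _ q0 p.
  by apply: filterS => y; exact: hU.
have r2 : 0 < r / 2 by lra.
have [bq _] := sing.
pose K := [set p | dist q0 p <= r / 2] `&` [set p | r / 2 <= dist q0 p].
have cK : compact K.
  apply: compact_closedI; first exact: compact_ball.
  rewrite (_ : [set p | _] = dist q0 @^-1` [set x | r / 2 <= x])//.
  by apply: closed_comp; [move=> q _; exact: dist_continuous|exact: closed_ge].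
have K0 : K !=set0.
  have [p dp _] := deep_point cE hS bq r2 ltr01 hU'.
  by exists p; rewrite /K /= dp lexx.
have depth_c : {within K, continuous (depth E)}.
  apply: continuous_in_subspaceT => p; rewrite inE => -[pK _].
  apply/cvgrPdist_lt => s s0.
  have Up := nbhs_singleton (hU' _ pK); near=> y.
  have Uy : Unp E y by near: y; exact: hU'.
  have dy : dist p y < s by near: y; exact: near_dist.
  have := depth_lip Up Uy; have := depth_lip Uy Up.
  by rewrite [dist y p]distC ltr_norml; lra.
have [p pK pmax] := compact_EVT_max K0 cK depth_c; rewrite inE in pK.
have [pr1 pr2] := pK.
have dp : dist q0 p = r / 2 by apply/eqP; rewrite eq_le pr1.
have deep : r / 2 <= depth E p.
  apply/ler_addgt0Pr => k k0.
  have [y dy hy] := deep_point cE hS bq r2 k0 hU'.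
  have : depth E y <= depth E p by apply: pmax; rewrite inE /K /= dy.
  by lra.
have Up := nbhs_singleton (hU' _ pr1).
have np : nearest E p q0.
  apply/nearestP; split; first by have [+ _] := bq; have /closure_id <- := cE.
  by move=> y Ey; rewrite distC dp; apply: le_trans deep _; exact: depth_le.
have := nearest_singular np cE sing => pq.
by move: dp; rewrite pq distxx; lra.
Unshelve. all: by end_near. Qed.

End Reach.

Theorem corollary3p14 (R : realType) (n : nat) (n_ge1 : (1 <= n)%N)
    (E : set (heis R n)) (E_closed : closed E)
    (S_C1 : C1_hypersurface (boundary E))
    (q0 : heis R n) (q0_sing : singular_set (boundary E) q0) :
  reach E q @[q --> within (boundary E) (nbhs q0)] --> 0%E.
Proof.
case: n n_ge1 E E_closed S_C1 q0 q0_sing => // m _ E cE hS q0 sing.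
suff key (e : R) : 0 < e -> \forall q \near q0, (0 <= reach E q <= e%:E)%E.
  move=> A /= [e /= e0 hA].
  have e2 : 0 < e / 2 by rewrite divr_gt0.
  have hk := key _ e2.
  apply: filterS hk => q /andP[h0 h1] _.
  have fin : reach E q \is a fin_num.
    by rewrite ge0_fin_numE//; apply: le_lt_trans h1 _; rewrite ltry.
  rewrite /= -(fineK fin); apply: hA; rewrite /= sub0r normrN ger0_norm ?fine_ge0//.
  by rewrite -lte_fin fineK//; apply: le_lt_trans h1 _; rewrite lte_fin; lra.
move=> e0; have e2 : 0 < e / 2 by rewrite divr_gt0.
have [p dp nU] := singular_notin_Unp cE hS sing e2.
apply: filterS (near_dist q0 e2) => q dq.
rewrite /reach le_max lexx /= ge_max lee_fin (ltW e0) /=.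
apply: ge_ereal_sup => _ [s [s0 hs] <-]; rewrite lee_fin leNgt; apply/negP => es.
apply: nU; apply: hs; rewrite /cc_ball /= cc_distE lte_fin.
by have := dist_triangle q q0 p; rewrite [dist q q0]distC; lra.
Qed.
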